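(* Let $\sigma>0$, $c_k=\exp(2\pi\sigma|k|)$ for $k\in\mathbb{Z}$ (analytic case), let $d=d_\varepsilon\to\infty$ as $\varepsilon\to0$ with $\log d=o(\log\varepsilon^{-1})$, and let $s=s_\varepsilon\in\{1,\dots,d\}$ be such that $s=o(d)$. Assume that $r_\varepsilon=r_\varepsilon(s)>0$ satisfies $$\limsup_{\varepsilon\to0}\frac{u_\varepsilon(r_\varepsilon)}{\sqrt{2\log(d/s)}}<1 .$$ Then $$\liminf_{\varepsilon\to0}\ \inf_{\tilde\eta}\ \sup_{\eta\in\mathcal{H}_{d,s}}\ \sup_{\theta\in\Theta_{\sigma,d}(r_\varepsilon)} s^{-1}\,\mathbf{E}_{\eta,\theta}|\eta-\tilde\eta|>0,$$ where the infimum is over all selectors $\tilde\eta$, i.e. all measurable functions of the observations $(X_{j,k})_{1\le j\le d,\,k\in\mathbb{Z}}$ with values in $\{0,1\}^d$.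
   Context: Model. For noise level $\varepsilon>0$ and dimension $d=d_\varepsilon$ one observes $X_{j,k}=\eta_j\theta_{j,k}+\varepsilon\xi_{j,k}$, $1\le j\le d$, $k\in\mathbb{Z}$, with $\xi_{j,k}$ i.i.d. $N(0,1)$. Expectation under this model is $\mathbf{E}_{\eta,\theta}$. Here $\eta\in\mathcal{H}_{d,s}=\{\eta\in\{0,1\}^d:\sum_{j=1}^d\eta_j=s\}$ and $\theta=(\theta_1,\dots,\theta_d)$ with $\theta_j=(\theta_{j,k})_{k\in\mathbb{Z}}$. For $a,b\in\{0,1\}^d$, $|a-b|=\sum_{j=1}^d|a_j-b_j|$ is the Hamming distance. Parameter sets. For $r>0$, $$\Theta_\sigma(r)=\Big\{\vartheta=(\vartheta_k)_{k\in\mathbb{Z}}\in l_2(\mathbb{Z}):\ \vartheta_0=0,\ \sum_{k}c_k^2\vartheta_k^2\le1,\ \sum_k\vartheta_k^2\ge r^2\Big\},$$ and $\Theta_{\sigma,d}(r)=\{\theta=(\theta_1,\dots,\theta_d):\theta_j\in\Theta_\sigma(r),\ 1\le j\le d\}$. The function $u_\varepsilon(r)\ge0$ is defined by $u_\varepsilon^2(r)=\frac{1}{2\varepsilon^4}\inf_{\vartheta\in\Theta_\sigma(r)}\sum_{k}\vartheta_k^4$ (with $\inf\emptyset=+\infty$). *)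

(* Defs.v *)
From mathcomp Require Export all_boot all_order all_algebra.
From mathcomp Require Export all_classical all_reals all_analysis.

Import Order.TTheory GRing.Theory Num.Theory.
Import numFieldNormedType.Exports.

Local Open Scope classical_set_scope.
Local Open Scope ring_scope.

Definition analytic_coef {R : realType} (sigma : R) (k : int) : R :=
  expR (2 * pi * sigma * `|k%:~R|).

(* The square-summability conjunct follows from the ellipsoid constraint; it
   records that the set consists of elements of l_2(Z). *)
Definition Theta {R : realType} (sigma r : R) : set (int -> R) :=
  [set v | [/\ (\esum_(k in [set: int]) (v k ^+ 2)%:E < +oo)%E,
               v 0 = 0,
               (\esum_(k in [set: int])
                  (analytic_coef sigma k ^+ 2 * v k ^+ 2)%:E <= 1)%E &
               ((r ^+ 2)%:E <= \esum_(k in [set: int]) (v k ^+ 2)%:E)%E]].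

Definition ThetaD {R : realType} (sigma r : R) (d : nat) :
    set ('I_d -> int -> R) :=
  [set theta | forall j, Theta sigma r (theta j)].

(* The value is +oo when [Theta sigma r] is empty. *)
Definition u_fun {R : realType} (sigma eps r : R) : \bar R :=
  sqrte (((2 * eps ^+ 4)^-1)%:E *
         ereal_inf [set (\esum_(k in [set: int]) (v k ^+ 4)%:E)%E
                   | v in Theta sigma r]).

Definition supports (d s : nat) : set {ffun 'I_d -> bool} :=
  [set eta : {ffun 'I_d -> bool} | (\sum_(j < d) eta j)%N = s].

Definition hamming {R : realType} {d : nat} (a b : {ffun 'I_d -> bool}) : R :=
  \sum_(j < d) `|(a j)%:R - (b j)%:R|.

Definition mutually_independent {R : realType} {disp : measure_display}
    {T : measurableType disp} (P : probability T R) {I : choiceType}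
    (X : I -> {RV P >-> R}) : Prop :=
  forall (J : seq I) (B : I -> set R), uniq J ->
    (forall i, measurable (B i)) ->
    P (\bigcap_(i in [set` J]) (X i @^-1` B i)) =
    (\prod_(i <- J) P (X i @^-1` B i))%E.

Definition iid_std_normal {R : realType} {disp : measure_display}
    {T : measurableType disp} (P : probability T R) {I : choiceType}
    (X : I -> {RV P >-> R}) : Prop :=
  (forall (i : I) (B : set R), measurable B ->
     distribution P (X i) B = normal_prob 0 1 B) /\
  mutually_independent P X.

Definition sample (R : realType) (d : nat) : Type := 'I_d * int -> R.

Definition observation {R : realType} {T : Type} {d : nat} (eps : R)
    (eta : {ffun 'I_d -> bool}) (theta : 'I_d -> int -> R)
    (xi : 'I_d * int -> T -> R) (w : T) : sample R d :=
  fun jk => (eta jk.1)%:R * theta jk.1 jk.2 + eps * xi jk w.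

(* Generators of the product sigma-algebra on the sample space. *)
Definition cylinders (R : realType) (d : nat) : set (set (sample R d)) :=
  [set C | exists (jk : 'I_d * int) (B : set R),
     measurable B /\ C = [set x | B (x jk)]].

(* Measurability is with respect to the product sigma-algebra on the sample
   space and the discrete one on {0,1}^d. *)
Definition selectors (R : realType) (d : nat) :
    set (sample R d -> {ffun 'I_d -> bool}) :=
  [set sel : sample R d -> {ffun 'I_d -> bool} |
     forall A : set {ffun 'I_d -> bool}, <<s cylinders R d >> (sel @^-1` A)].

Definition minimax_risk {R : realType} {disp : measure_display}
    {T : measurableType disp} (P : probability T R)
    (sigma eps r : R) (d s : nat) (xi : 'I_d * int -> {RV P >-> R}) : \bar R :=
  ereal_inf [set ereal_sup [set ereal_sup [set
      ((s%:R^-1)%:E *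
       'E_P[(fun w => hamming eta (sel (observation eps eta theta xi w)))])%E
    | theta in ThetaD sigma r d]
    | eta in supports d s]
    | sel in selectors R d].

(* Main.v *)
From HB Require Import structures.
From mathcomp Require Import measurable_realfun ring lra.
Require Import Defs.
Import Order.TTheory GRing.Theory Num.Theory.
Import numFieldNormedType.Exports.
Local Open Scope classical_set_scope.
Local Open Scope ring_scope.
Set Implicit Arguments.
Unset Strict Implicit.
Unset Printing Implicit Defensive.

(** The risk stays bounded away from zero because a finite subfamily of the
parameters already defeats every selector.  Cut s * (d %/ s) coordinates into
s blocks of size m = d %/ s.  The prior activates exactly one coordinate of
each block, at a uniform position, and gives it a signal of constant modulus
eps * tau on the frequencies 1 <= |l| <= M, with independent uniform signs.

The Hamming loss is at least the number of blocks on which the selector differs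
from the indicator of the true position ([hamming_ge]).  Fix a block and all the
randomness of the others, let mu be the law of the data when that block carries
no signal, and let Lambda_i be the likelihood ratio, averaged over the signs, of
position i against mu.  The events A_i that the selector answers exactly i are
disjoint, so for every threshold C the average success probability is
  m^-1 \sum_i \int_(A_i) Lambda_i dmu
    <= C / m + \int_(Lambda > C) Lambda dmu,
and the last integral is at most KL / (ln C - 1), where KL is the divergence of
the sign mixture from mu; this Fano-type inequality is [mixture_lr_le].

The divergence is a sum over the 2 M frequencies, and replacing N(tau, 1) by the
symmetric mixture of N(tau, 1) and N(-tau, 1) makes each term
tau ^ 4 / 4 + O(tau ^ 6) ([kl_rate_le]), where the chi-square bound would give
tau ^ 4 / 2.  Hence KL is asymptotically u ^ 2 / 2 for u ^ 2 = M * tau ^ 4, and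
it is a fraction p < 1 of ln (d / s) as soon as u ^ 2 <= 2 * p * ln (d / s).
With C a small multiple of m the success probability stays below 1.

The change of measure behind the likelihood ratios is a Cameron-Martin formula
([law_shift]): on coordinate boxes it follows from independence and from the
translation of a single Gaussian, and boxes are a pi-system.

What remains is that a flat signal is as hard as the extremal one
([flat_signal_exists]).  The analytic weights cut the spectrum sharply: beyond
N = ln (1 / eps) / (2 pi sigma) frequencies any admissible signal has energy at
most eps ^ 2, while on slightly fewer than N frequencies the ellipsoid constraint
is void.  Cauchy-Schwarz on the first N frequencies therefore bounds the radius
of every signal by that of a flat one whose fourth moment is barely larger.  The
hypothesis ln d = o(ln (1 / eps)) makes M much larger than ln (d / s), so that
tau tends to 0 and the O(tau ^ 6) terms are negligible. *)

(** * Densities and translated Gaussians *)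

(** A density agrees almost everywhere with the Radon-Nikodym derivative, for which
the change of variables is known. *)
Lemma ge0_integral_density dT (T : measurableType dT) (R : realType)
    (mu : {sigma_finite_measure set T -> \bar R})
    (nu : {finite_measure set T -> \bar R}) (D : T -> R) :
  measurable_fun setT D -> (forall x, 0 <= D x) ->
  (forall A, measurable A -> nu A = \int[mu]_(x in A) (D x)%:E)%E ->
  forall (f : T -> \bar R) (E : set T), measurable E ->
  measurable_fun setT f -> (forall x, 0 <= f x)%E ->
  (\int[nu]_(x in E) f x = \int[mu]_(x in E) (f x * (D x)%:E))%E.
Proof.
move=> mD D0 nuD f E mE mf f0.
have mDe : measurable_fun setT (EFin \o D) by apply/measurable_EFinP.
have numu : nu `<< mu.
  apply/null_content_dominatesP => A mA muA0; rewrite nuD//.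
  by apply: null_set_integral => //; exact: measurable_funTS.
rewrite -(Radon_Nikodym_SigmaFinite.change_of_variables numu)//; last first.
  exact: measurable_funTS.
set g := Radon_Nikodym_SigmaFinite.f _ _.
have gint : mu.-integrable setT g by exact: Radon_Nikodym_SigmaFinite.f_integrable.
have mg : measurable_fun setT g by exact: measurable_int gint.
have g0 x : (0 <= g x)%E by exact: Radon_Nikodym_SigmaFinite.f_ge0.
apply: ge0_ae_eq_integral => //.
- by apply: measurable_funTS; exact: emeasurable_funM.
- by apply: measurable_funTS; exact: emeasurable_funM.
- by move=> x _; rewrite mule_ge0.
- by move=> x _; rewrite mule_ge0// lee_fin.
apply: ae_eqe_mul2l.
apply: integral_ae_eq => //.
- exact: integrableS gint.
- exact: measurable_funTS.
move=> A _ mA.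
by rewrite -nuD// /g -Radon_Nikodym_SigmaFinite.f_integral.
Qed.

Lemma lebesgue_measure_shift (R : realType) (t : R) (A : set R) :
  measurable A ->
  lebesgue_measure ((fun y => y + t) @^-1` A) = lebesgue_measure A.
Proof.
move=> mA.
have ms : measurable_fun setT (fun y : R => y + t) by exact: measurable_funD.
pose f : {mfun measurableTypeR R >-> measurableTypeR R} := HB.pack (fun y : R => y + t)
  (isMeasurableFun.Build _ _ (measurableTypeR R) (measurableTypeR R) _ ms).
apply/esym.
have H : forall X, ocitv X -> lebesgue_measure X = pushforward lebesgue_measure f X.
  move=> X [[a b] _ <-] /=.
  rewrite /pushforward /= (_ : _ @^-1` _ = `]a - t, b - t]%classic); last first.
    by apply/seteqP; split => y /=; rewrite !in_itv/= ltrBlDr lerBrDr.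
  rewrite !lebesgue_measure_itv /= !lte_fin ltrD2r.
  by case: ifP => // _; rewrite -!EFinB; congr (_%:E); ring.
exact: (@lebesgue_measure_unique R (pushforward lebesgue_measure f) H A mA).
Qed.

(** One-dimensional Cameron-Martin formula: tilting the standard Gaussian density
by exp (t y - t^2/2) completes the square into the density centred at t. *)
Lemma normal_prob_shift (R : realType) (t : R) (A : set R) :
  measurable A ->
  normal_prob 0 1 ((fun y => y + t) @^-1` A) =
  (\int[normal_prob 0 1]_(y in A) (expR (t * y - t ^+ 2 / 2))%:E)%E.
Proof.
move=> mA.
have ms : measurable_fun setT (fun y : R => y + t) by exact: measurable_funD.
have pdfS y : normal_pdf 0 1 y * expR (t * y - t ^+ 2 / 2) = normal_pdf 0 1 (y - t).
  rewrite !normal_pdfE ?oner_neq0// /normal_fun -mulrA -expRD; congr (_ * expR _).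
  by rewrite !subr0 expr1n; field.
have mpdf := @measurable_normal_pdf R 0 1.
have mpdfe : measurable_fun setT (EFin \o normal_pdf (0:R) 1) by apply/measurable_EFinP.
have mE : measurable_fun setT (EFin \o (fun y : R => expR (t * y - t ^+ 2 / 2))).
  apply/measurable_EFinP; apply: measurableT_comp => //.
  by apply: measurable_funB => //; exact: measurable_funM.
rewrite (@ge0_integral_density _ (measurableTypeR R) R lebesgue_measure
  (normal_prob 0 1) (normal_pdf 0 1))//; last first.
  by move=> y; exact: normal_pdf_ge0.
rewrite /normal_prob.
under [RHS]eq_integral do rewrite -EFinM mulrC pdfS.
pose f : {mfun measurableTypeR R >-> measurableTypeR R} := HB.pack (fun y : R => y + t)
  (isMeasurableFun.Build _ _ (measurableTypeR R) (measurableTypeR R) _ ms).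
have -> : (\int[lebesgue_measure]_(x in A) (normal_pdf 0 1 (x - t))%:E =
  \int[pushforward lebesgue_measure f]_(x in A) (normal_pdf 0 1 (x - t))%:E)%E.
  apply: eq_measure_integral => B mB _.
  exact/esym/lebesgue_measure_shift.
rewrite ge0_integral_pushforward//.
- by apply: eq_integral => y _; rewrite /comp addrK.
- apply/measurable_EFinP/measurable_funTS.
  by apply: (measurableT_comp mpdf); exact: measurable_funB.
- by move=> y _; rewrite lee_fin normal_pdf_ge0.
Qed.

(** Independence is only assumed on events.  It says that the trace of P on E,
pushed forward by X, is the measure N scaled by P E, and integrals follow the
measures. *)
Lemma ge0_integral_indep dT (T : measurableType dT) dT' (T' : measurableType dT')
    (R : realType) (P : probability T R) (N : probability T' R)
    (X : {mfun T >-> T'}) (E : set T) :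
  measurable E ->
  (forall B, measurable B -> P (E `&` X @^-1` B) = P E * N B)%E ->
  forall (B : set T') (h : T' -> R), measurable B ->
  measurable_fun setT h -> (forall y, 0 <= h y) ->
  (\int[P]_(w in E `&` X @^-1` B) (h (X w))%:E = P E * \int[N]_(y in B) (h y)%:E)%E.
Proof.
move=> mE EX B h mB mh h0.
have mXB : measurable (X @^-1` B) by rewrite -[_ @^-1` _]setTI; exact: measurable_funP.
have mhX : measurable_fun setT (fun w => (h (X w))%:E).
  by apply/measurable_EFinP; exact: measurableT_comp.
rewrite setIC integral_mkcondr.
under eq_integral do rewrite epatch_indic.
have restrE A : measurable A ->
    mrestr P mE A = (\int[P]_(x in A) (\1_E x : R)%:E)%E.
  by move=> mA; rewrite integral_indic// /mrestr setIC.
have E0 (w : T) : (0 <= \1_E w :> R) by [].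
have mI : measurable_fun setT (\1_E : T -> R) by exact: measurable_indic.
have := @ge0_integral_density _ T R P (mrestr P mE) (\1_E) mI E0 restrE
  (fun w => (h (X w))%:E) _ mXB mhX.
move=> <-; last by move=> w; rewrite lee_fin.
have PEfin : P E \is a fin_num by exact: fin_num_measure.
have PE0 : 0 <= fine (P E) by exact: fine_ge0.
transitivity (\int[pushforward (mrestr P mE) X]_(y in B) (h y)%:E)%E.
  rewrite ge0_integral_pushforward//.
  by apply/measurable_funTS/measurable_EFinP.
  by move=> y _; rewrite lee_fin.
transitivity (\int[mscale (NngNum PE0) N]_(y in B) (h y)%:E)%E.
  apply: eq_measure_integral => A mA _.
  transitivity (P (E `&` X @^-1` A)); first by rewrite setIC.
  rewrite EX//; transitivity ((fine (P E))%:E * N A)%E => //.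
  by rewrite fineK.
rewrite ge0_integral_mscale//.
- by congr (_ * _)%E; rewrite /= fineK.
- by apply/measurable_funTS/measurable_EFinP.
- by move=> y _; rewrite lee_fin.
Qed.

(** Made a measure so that the uniqueness theorem for measures on a pi-system
applies to exponential densities. *)
Definition tilt dT (T : measurableType dT) (R : realType)
  (mu : {measure set T -> \bar R}) (D : T -> R) (A : set T) : \bar R :=
  (\int[mu]_(x in A) (expR (D x))%:E)%E.

Section tilt_measure.
Context dT (T : measurableType dT) (R : realType)
  (mu : {measure set T -> \bar R}) (D : {mfun T >-> R}).

Let mE : measurable_fun setT (fun x => (expR (D x))%:E).
Proof. by apply/measurable_EFinP; exact: measurableT_comp. Qed.

Let tilt0 : tilt mu D set0 = 0%E.
Proof. by rewrite /tilt integral_set0. Qed.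

Let tilt_ge0 A : (0 <= tilt mu D A)%E.
Proof. by apply: integral_ge0 => x _; rewrite lee_fin expR_ge0. Qed.

Let tilt_sigma_additive : semi_sigma_additive (tilt mu D).
Proof.
move=> /= F mF tF mUF; rewrite /tilt ge0_integral_bigcup//=.
- by apply: is_cvg_ereal_nneg_natsum_cond => n _ _; exact: tilt_ge0.
- exact: measurable_funTS.
Qed.

HB.instance Definition _ := isMeasure.Build _ _ _
  (tilt mu D) tilt0 tilt_ge0 tilt_sigma_additive.
End tilt_measure.

(** * Exact integrals of linear combinations *)

Section has_integral.
Context dT (T : measurableType dT) (R : realType) (mu : probability T R).

(** Integrability and value are carried together because the likelihood-ratio
computations are linear algebra over finitely many exponentials, with
coefficients of both signs. *)
Definition has_integral (f : T -> R) (v : R) :=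
  mu.-integrable setT (EFin \o f) /\ (\int[mu]_x (f x)%:E = v%:E)%E.

Lemma has_integral_cst (c : R) : has_integral (cst c) c.
Proof.
split; first exact: finite_measure_integrable_cst.
transitivity (\int[mu]_x (cst c%:E x))%E => //.
by rewrite integral_cst//= -[RHS]mule1; congr (_ * _)%E; exact: probability_setT.
Qed.

Lemma has_integralD f g u v : has_integral f u -> has_integral g v ->
  has_integral (fun x => f x + g x) (u + v).
Proof.
move=> [fi fu] [gi gv]; split.
  apply: (eq_integrable _ _ _ _ (integrableD _ fi gi)) => // x _.
under eq_integral do rewrite EFinD.
by rewrite integralD// fu gv.
Qed.

Lemma has_integralZ f u c : has_integral f u ->
  has_integral (fun x => c * f x) (c * u).
Proof.
move=> [fi fu]; split.
  apply: (eq_integrable _ _ _ _ (integrableZl _ c fi)) => // x _.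
under eq_integral do rewrite EFinM.
by rewrite integralZl// fu.
Qed.

Lemma has_integral_sum (I : Type) (s : seq I) (f : I -> T -> R) (v : I -> R) :
  (forall i, has_integral (f i) (v i)) ->
  has_integral (fun x => \sum_(i <- s) f i x) (\sum_(i <- s) v i).
Proof.
move=> H; elim: s => [|i s IH].
  rewrite big_nil (_ : (fun _ => _) = cst 0); first exact: has_integral_cst.
  by apply/funext => x; rewrite big_nil.
rewrite big_cons (_ : (fun _ => _) = (fun x => f i x + \sum_(i <- s) f i x)).
  exact: has_integralD.
by apply/funext => x; rewrite big_cons.
Qed.

Lemma eq_has_integral f g v : has_integral f v -> f =1 g -> has_integral g v.
Proof. by move=> H /funext <-. Qed.

Lemma has_integral_val f u v : has_integral f u -> u = v -> has_integral f v.
Proof. by move=> H <-. Qed.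

Lemma has_integral_indic (A : set T) : measurable A ->
  has_integral \1_A (fine (mu A)).
Proof.
move=> mA; split; first exact: integrable_indic.
by rewrite integral_indic// setIT fineK// fin_num_measure.
Qed.

Lemma has_integral_le f g u v :
  has_integral f u -> has_integral g v -> (forall x, f x <= g x) -> u <= v.
Proof.
move=> [fi fu] [gi gv] fg; rewrite -lee_fin -fu -gv.
by apply: le_integral => // x _; rewrite lee_fin.
Qed.

(** Disjointness means that the indicators add up to at most 1 pointwise. *)
Lemma sum_disjoint_le1 (m : nat) (A : 'I_m -> set T) :
  (forall i, measurable (A i)) ->
  (forall i j x, A i x -> A j x -> i = j) ->
  \sum_i fine (mu (A i)) <= 1.
Proof.
move=> mA dA.
have HA i : has_integral (\1_(A i)) (fine (mu (A i))) by exact: has_integral_indic.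
apply: (has_integral_le (@has_integral_sum _ (index_enum 'I_m) _ _ HA)
  (has_integral_cst 1)) => x /=.
have [[i Aix]|nA] := pselect (exists i, A i x).
  rewrite (bigD1 i)//= big1 ?addr0 ?indicE ?lern1 ?leq_b1// => j ji.
  by rewrite indicE memNset// => Ajx; rewrite (dA _ _ _ Ajx Aix) eqxx in ji.
rewrite big1// => i _; rewrite indicE memNset// => Aix.
by apply: nA; exists i.
Qed.

End has_integral.

(** * Translating finitely many Gaussian coordinates *)

Section observations.
Context (R : realType) (d : nat).

(** The restricted coordinates are recorded by a list J outside of which the
factors are the whole line, so that intersecting two boxes is intersecting
factors: this is the pi-system on which laws are compared. *)
Definition box_sets : set (set (sample R d)) :=
  [set C | exists (J : seq ('I_d * int)) (B : 'I_d * int -> set R),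
     [/\ forall i, measurable (B i), forall i, i \notin J -> B i = setT &
         C = [set x | forall i, B i (x i)]]].

Local Notation space := (g_sigma_algebraType (cylinders R d)).

Lemma measurable_coord (i : 'I_d * int) :
  measurable_fun setT (fun x : space => x i).
Proof.
move=> _ B mB; rewrite setTI; apply: sub_sigma_algebra.
by exists i, B.
Qed.

Lemma box_sets_setI : setI_closed box_sets.
Proof.
move=> _ _ [J [B [mB BJ ->]]] [J' [B' [mB' BJ' ->]]].
exists (J ++ J'), (fun i => B i `&` B' i); split.
- by move=> i; exact: measurableI.
- by move=> i; rewrite mem_cat negb_or => /andP[iJ iJ']; rewrite BJ// BJ'// setTI.
- apply/seteqP; split => x /=.
    by move=> [Bx B'x] i; split.
  by move=> h; split => i; have [] := h i.
Qed.

Lemma box_sets_measurable (C : set space) : box_sets C -> measurable C.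
Proof.
move=> [J [B [mB BJ ->]]].
rewrite (_ : mkset _ = \bigcap_(i in [set` J]) [set x : space | B i (x i)]).
  apply: fin_bigcap_measurable => // i _.
  by rewrite -[X in measurable X]setTI; exact: measurable_coord.
apply/seteqP; split => x /= Bx; first by move=> i _; exact: Bx.
by move=> i; have [iJ|iJ] := boolP (i \in J); [exact: Bx|rewrite BJ].
Qed.

Lemma measurable_box_sets : (@measurable _ space) = <<s box_sets >>.
Proof.
apply/seteqP; split.
- apply: sub_sigma_algebra2 => _ [i [B [mB ->]]].
  exists [:: i], (fun j => if j == i then B else setT); split.
  + by move=> j; case: ifP.
  + by move=> j; rewrite inE; case: eqP.
  + apply/seteqP; split => x /=; first by move=> Bx j; case: eqP => // ->.
    by move=> /(_ i); rewrite eqxx.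
- apply: smallest_sub; first exact: sigma_algebra_measurable.
  exact: box_sets_measurable.
Qed.

Context (disp : measure_display) (T : measurableType disp)
  (P : probability T R) (eps : R) (xi : 'I_d * int -> {RV P >-> R}).

Definition obs (a : 'I_d * int -> R) (w : T) : space :=
  fun i => a i + eps * xi i w.

Lemma measurable_obs_coord (a : 'I_d * int -> R) i :
  measurable_fun setT (fun w => a i + eps * xi i w).
Proof.
by apply: measurable_funD => //; apply: measurable_funM => //.
Qed.

Lemma measurable_obs a : measurable_fun setT (obs a).
Proof.
apply: (@measurability _ _ T space _ _ (cylinders R d)) => //.
move=> _ [_ [i [B [mB ->]]] <-].
exact: (measurable_obs_coord a i).
Qed.

HB.instance Definition _ a := isMeasurableFun.Build _ _ _ _ (obs a) (measurable_obs a).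

Definition law a : probability space R := distribution P (obs a).

Hypothesis xi_iid : iid_std_normal P xi.

Lemma law_box (J : seq ('I_d * int)) (B : 'I_d * int -> set R) a :
  uniq J -> (forall i, measurable (B i)) -> (forall i, i \notin J -> B i = setT) ->
  law a [set x | forall i, B i (x i)] =
  (\prod_(i <- J) normal_prob 0 1 ((fun y => (a i + eps * y)%R) @^-1` B i))%E.
Proof.
move=> uJ mB BJ.
have mf i : measurable_fun setT (fun y : R => a i + eps * y).
  by apply: measurable_funD => //; apply: measurable_funM.
have mB' i : measurable ((fun y : R => (a i + eps * y)%R) @^-1` B i).
  by rewrite -[X in measurable X]setTI; exact: mf.
have [xiN xiI] := xi_iid.
rewrite (eq_bigr (fun i => P (xi i @^-1` ((fun y => (a i + eps * y)%R) @^-1` B i))));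
  last first.
  by move=> i _; rewrite -(xiN i _ (mB' i)).
rewrite -xiI//; congr (P _).
apply/seteqP; split => w /= h; first by move=> i _; exact: h.
by move=> i; have [iJ|iJ] := boolP (i \in J); [exact: (h i iJ)|rewrite BJ].
Qed.

(** Shifts are measured in units of the noise level, so that eps disappears from
the exponents of the densities. *)
Definition shift1 (a : 'I_d * int -> R) i (t : R) : 'I_d * int -> R :=
  fun j => a j + (j == i)%:R * (eps * t).

(** Both sides are measures in C, so it is enough to compare them on boxes.  There
the coordinate i splits off by independence and the claim is
[normal_prob_shift]. *)
Lemma law_shift1 (a : 'I_d * int -> R) i (t : R) (C : set space) : eps != 0 ->
  measurable C ->
  law (shift1 a i t) C =
  (\int[law a]_(x in C) (expR (t * ((x i - a i) / eps) - t ^+ 2 / 2))%:E)%E.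
Proof.
move=> e0 mC.
have [xiN xiI] := xi_iid.
have mD : measurable_fun setT (fun x : space => t * ((x i - a i) / eps) - t ^+ 2 / 2).
  apply: measurable_funB => //; apply: measurable_funM => //.
  apply: measurable_funM => //; apply: measurable_funB => //.
  exact: measurable_coord.
pose D : {mfun space >-> R} := HB.pack (fun x : space => t * ((x i - a i) / eps) - t ^+ 2 / 2)
  (isMeasurableFun.Build _ _ _ _ _ mD).
have mexp : measurable_fun setT (fun x : space => (expR (D x))%:E).
  by apply/measurable_EFinP; exact: measurableT_comp.
change (law (shift1 a i t) C = tilt (law a) D C).
pose m2 : {measure set space -> \bar R} := tilt (law a) D.
apply: (@measure_unique _ R space box_sets (fun _ => setT) _ _ _ _
  (law (shift1 a i t)) m2) => //.
- exact: measurable_box_sets.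
- exact: box_sets_setI.
- move=> _; exists [::], (fun _ => setT); split => //.
  by apply/seteqP; split.
- by apply/seteqP; split => // x _; exists 0%N.
- move=> _ [J [B [mB BJ ->]]].
  pose J0 := undup [seq j <- J | j != i].
  have iJ0 : i \notin J0 by rewrite mem_undup mem_filter eqxx.
  have uJ : uniq (i :: J0) by rewrite /= iJ0 undup_uniq.
  have JJ0 j : j \notin i :: J0 -> j \notin J.
    by rewrite inE negb_or mem_undup mem_filter => /andP[-> /=].
  have mf (c : R) : measurable_fun setT (fun y : R => c + eps * y).
    by apply: measurable_funD => //; apply: measurable_funM.
  pose B' j := (fun y : R => a j + eps * y) @^-1` B j.
  have mB' j : measurable (B' j).
    by rewrite -[X in measurable X]setTI; exact: mf.
  etransitivity; first by apply: (@law_box (i :: J0)) => // j /JJ0/BJ.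
  rewrite big_cons (eq_big_seq (fun j => normal_prob 0 1 (B' j))); last first.
    move=> j jJ0; rewrite /shift1 (_ : (j == i) = false) ?mul0r ?addr0//.
    by apply: contraNF iJ0 => /eqP <-.
  pose E := \bigcap_(j in [set` J0]) (xi j @^-1` B' j).
  have PJ0 : P E = (\prod_(j <- J0) normal_prob 0 1 (B' j))%E.
    rewrite /E xiI ?undup_uniq//.
    by apply: eq_bigr => j _; rewrite -(xiN j _ (mB' j)).
  have mE : measurable E.
    apply: fin_bigcap_measurable => // j _.
    by rewrite -[X in measurable X]setTI; exact: measurable_funP.
  have EX A : measurable A -> (P (E `&` xi i @^-1` A) = P E * normal_prob 0 1 A)%E.
    move=> mA; rewrite PJ0 -(xiN i _ mA) muleC.
    transitivity (\prod_(j <- i :: J0) P (xi j @^-1` (if j == i then A else B' j)))%E.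
      rewrite -xiI//; last by move=> j; case: ifP.
      congr (P _).
      have ne j : j \in J0 -> (j == i) = false.
        by move=> jJ0; apply: contraNF iJ0 => /eqP <-.
      apply/seteqP; split => w /=.
        move=> [h1 h2] j /=; rewrite inE => /orP[/eqP ->|jJ0]; first by rewrite eqxx.
        by rewrite ne//; exact: h1.
      move=> h; split; last by have := h i (mem_head _ _); rewrite eqxx.
      by move=> j jJ0; have := h j; rewrite /= inE ne//=; apply.
    rewrite big_cons eqxx; congr (_ * _)%E.
    apply: eq_big_seq => j jJ0; rewrite (_ : (j == i) = false) -?(xiN j _ (mB' j))//.
    by apply: contraNF iJ0 => /eqP <-.
  have mbox : measurable ([set x | forall i, B i (x i)] : set space).
    by apply: box_sets_measurable; exists J, B.
  transitivity (\int[pushforward P (obs a)]_(x in [set x | forall i, B i (x i)])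
     (expR (D x))%:E)%E; last by [].
  rewrite ge0_integral_pushforward//; last exact: (measurable_funTS mexp).
  have -> : obs a @^-1` [set x | forall i, B i (x i)] = E `&` xi i @^-1` B' i.
    apply/seteqP; split => w /=.
      by move=> h; split=> [j _|]; exact: h.
    move=> [h1 h2] j; have [jJ|] := boolP (j \in i :: J0); last by move/JJ0/BJ ->.
    by move: jJ; rewrite inE => /orP[/eqP ->//|jJ0]; exact: h1.
  transitivity (\int[P]_(w in E `&` xi i @^-1` B' i)
      (expR (t * xi i w - t ^+ 2 / 2))%:E)%E; last first.
    have DE w : D (obs a w) = t * xi i w - t ^+ 2 / 2.
      by rewrite /D/= /obs; field.
    by apply: eq_integral => w _; rewrite -DE.
  have mxi : @measurable_fun _ _ T (measurableTypeR R) setT (xi i).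
    by move=> mT A mA; rewrite setTI; exact: measurable_funPTI.
  pose X : {mfun T >-> measurableTypeR R} := HB.pack (xi i : T -> R)
    (isMeasurableFun.Build _ _ T (measurableTypeR R) _ mxi).
  rewrite (@ge0_integral_indep _ T _ _ R P (@normal_prob R 0 1) X E mE EX
     (B' i) (fun y => expR (t * y - t ^+ 2 / 2)))//; last first.
    apply: measurableT_comp => //.
    by apply: measurable_funB => //; exact: measurable_funM.
    exact: (mB' i).
  rewrite [RHS]muleC PJ0 -(normal_prob_shift t (mB' i)).
  congr (normal_prob 0 1 _ * _)%E.
  apply/seteqP; split => y; rewrite /B' /= /shift1 eqxx mul1r mulrDr addrA.
    by rewrite addrAC.
  by rewrite addrAC.
- by move=> _; rewrite (le_lt_trans (probability_le1 _ _))// ltry.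
Qed.

(** Coordinates are shifted one at a time; the density of the shifts already made
is integrated against the next one.  The shifted coordinates start at mean 0,
and injectivity of iota keeps each of them at 0 until its turn. *)
Lemma law_shift (K : eqType) (iota : K -> 'I_d * int) (c : K -> R)
    (a : 'I_d * int -> R) (l : seq K) (C : set space) :
  eps != 0 -> injective iota -> (forall k, a (iota k) = 0) -> uniq l ->
  measurable C ->
  law (fun j => a j + eps * \sum_(k <- l) (j == iota k)%:R * c k) C =
  (\int[law a]_(x in C)
     (expR (\sum_(k <- l) (c k * (x (iota k) / eps) - c k ^+ 2 / 2)))%:E)%E.
Proof.
move=> e0 inj a0; elim: l C => [|k l IH] C /= ul mC.
  rewrite (_ : (fun _ => _) = a); last first.
    by apply/funext => j; rewrite big_nil mulr0 addr0.
  under eq_integral do rewrite big_nil expR0.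
  by rewrite integral_cst// mul1e.
move: ul => /andP[kl ul].
set a' := fun j => a j + eps * \sum_(k <- l) (j == iota k)%:R * c k.
have a'k : a' (iota k) = 0.
  rewrite /a' a0 add0r big_seq big1 ?mulr0// => k' k'l.
  rewrite (_ : (iota k == iota k') = false) ?mul0r//.
  by apply: contraNF kl => /eqP/inj ->.
rewrite (_ : (fun _ => _) = shift1 a' (iota k) (c k)); last first.
  by apply/funext => j; rewrite big_cons /shift1 /a'; ring.
rewrite law_shift1// a'k.
have msum : measurable_fun setT (fun x : space =>
    \sum_(k <- l) (c k * (x (iota k) / eps) - c k ^+ 2 / 2)).
  apply: measurable_sum => k'; apply: measurable_funB => //.
  apply: measurable_funM => //; apply: measurable_funM => //.
  exact: measurable_coord.
pose D x := expR (\sum_(k <- l) (c k * (x (iota k) / eps) - c k ^+ 2 / 2)).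
have mD : measurable_fun setT (D : space -> R) by exact: measurableT_comp.
rewrite (@ge0_integral_density _ space R (law a) (law a') D mD)//.
- by apply: eq_integral => x _; rewrite -EFinM -expRD big_cons subr0.
- by move=> x; exact: expR_ge0.
- by move=> A mA; exact: IH.
- apply/measurable_EFinP; apply: measurableT_comp => //.
  apply: measurable_funB => //; apply: measurable_funM => //.
  apply: measurable_funM => //; apply: measurable_funB => //.
  exact: measurable_coord.
Qed.

End observations.

(** * Divergence of a symmetric pair of Gaussians *)

Section elementary.
Context (R : realType).
Implicit Types x y t v E : R.

(** The difference of the two sides vanishes at 1 and has derivative
(x - 1)^3 / x, which has the sign of x - 1. *)
Lemma ln_taylor3 x : 0 < x ->
  ln x <= (x - 1) - (x - 1) ^+ 2 / 2 + (x - 1) ^+ 3 / 3.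
Proof.
move=> x0.
pose f y := (y - 1) - (y - 1) ^+ 2 / 2 + (y - 1) ^+ 3 / 3 - ln y.
pose f' y := (y - 1) ^+ 3 / y.
have df y : 0 < y -> is_derive y (1 : R) f (f' y).
  move=> y0; rewrite /f.
  have := is_derive1_ln y0 => dln.
  apply: is_derive_eq.
  rewrite /f' /GRing.scale /=.
  have ? : y != 0 by rewrite gt_eqF.
  by field.
have f1 : f 1 = 0 by rewrite /f ln1 subrr !expr0n/=; ring.
suff : 0 <= f x by rewrite /f subr_ge0.
have cf a b : 0 < a -> {within `[a, b], continuous f}.
  move=> a0; apply: derivable_within_continuous => y; rewrite in_itv/= => /andP[ay _].
  by have [] := df y (lt_le_trans a0 ay).
case: (ltgtP x 1) => [x1|x1|->]; last by rewrite f1.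
- have [] := @MVT R f f' x 1 x1 _ (cf _ _ x0).
    by move=> y; rewrite in_itv/= => /andP[xy _]; exact: df (lt_trans x0 xy).
  move=> c; rewrite in_itv/= => /andP[xc c1]; rewrite f1 sub0r => /eqP.
  rewrite eqr_oppLR => /eqP ->.
  rewrite -mulNr mulr_ge0 ?subr_ge0 ?(ltW x1)// /f' -mulNr divr_ge0 ?(ltW (lt_trans x0 xc))//.
  by rewrite (_ : - _ = (1 - c) ^+ 3); [rewrite exprn_ge0// subr_ge0 ltW|ring].
- have [] := @MVT R f f' 1 x x1 _ (cf _ _ ltr01).
    by move=> y; rewrite in_itv/= => /andP[xy _]; exact: df (lt_trans ltr01 xy).
  move=> c; rewrite in_itv/= => /andP[c1 cx]; rewrite f1 subr0 => ->.
  rewrite mulr_ge0 ?subr_ge0 ?(ltW x1)// /f' divr_ge0 ?(ltW (lt_trans ltr01 c1))//.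
  by rewrite exprn_ge0// subr_ge0 ltW.
Qed.

(** The third Taylor polynomial of ln at 1, expanded in powers of y: moments of
the likelihood ratio under Gaussian laws are explicit in this form. *)
Definition log_majorant (y : R) := - (11 / 6) + 3 * y - 3 / 2 * y ^+ 2 + y ^+ 3 / 3.

Lemma ln_le_majorant y : 0 < y -> ln y <= log_majorant y.
Proof.
move=> /ln_taylor3 h; apply: (le_trans h); rewrite /log_majorant.
by rewrite le_eqVlt; apply/orP; left; apply/eqP; field.
Qed.

(** The integral of [log_majorant] of the likelihood ratio of
(N(tau,1) + N(-tau,1))/2 against N(0,1), under N(tau,1), with t = tau^2.  It
bounds the Kullback-Leibler divergence of that mixture from N(0,1). *)
Definition kl_rate t := (expR (6 * t) + 1) / 24 - 3 / 8 * expR (3 * t)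
  + 3 / 2 * expR t + 3 / 8 * expR (- t) + expR (- (2 * t)) / 8 - 41 / 24.

(** In the variable expR t = 1 + v the rate is a rational function whose value and
first derivative vanish at v = 0 and whose second derivative there is 1/2, so
the claim is a polynomial inequality on [0, 1]; 5 is a comfortable constant. *)
Lemma kl_rate_le t v : 0 <= t -> v = expR t - 1 -> v <= 1 ->
  kl_rate t <= v ^+ 2 / 4 + 5 * v ^+ 3.
Proof.
move=> t0 vE v1; have v0 : 0 <= v by rewrite vE subr_ge0 -expR0 ler_expR.
(* The quotient collects what remains after the leading terms; its numerator is
   positive on [0, 1]. *)
have -> : kl_rate t = v ^+ 2 / 4 + 5 * v ^+ 3 -
   v ^+ 3 * (130 + 221 * v + 73 * v ^+ 2 - 28 * v ^+ 3 - 8 * v ^+ 4 - v ^+ 5)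
     / (24 * (1 + v) ^+ 2).
  have e0 : expR t != 0 by rewrite gt_eqF// expR_gt0.
  rewrite /kl_rate !expRN !expRM_natl -[expR t](addrNK 1) -vE addrC.
  have ? : v + 1 != 0 by rewrite vE addrNK.
  by field; lra.
have h i : v ^+ i <= 1 by rewrite exprn_ile1.
have num0 : 0 <= 130 + 221 * v + 73 * v ^+ 2 - 28 * v ^+ 3 - 8 * v ^+ 4 - v ^+ 5.
  by move: (h 3) (h 4) (h 5) (exprn_ge0 2 v0) (v0); clear; lra.
have den0 : 0 <= 24 * (1 + v) ^+ 2.
  by apply: mulr_ge0; [exact: ler0n|exact: sqr_ge0].
rewrite lerBlDr lerDl; apply: divr_ge0 den0; apply: mulr_ge0 num0.
exact: exprn_ge0.
Qed.

End elementary.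

(** * Likelihood ratio of a random-sign signal *)

Section mixture.
Context dT (T : measurableType dT) (R : realType) (mu : probability T R)
  (K : finType) (y : K -> T -> R).

(** Likelihood ratio of a translation by c, in the noise-normalised coordinates y. *)
Definition shift_lr (c : K -> R) (x : T) : R :=
  expR (\sum_k (c k * y k x - c k ^+ 2 / 2)).

Definition sign_lr (tau : R) (g : {ffun K -> bool}) : T -> R :=
  shift_lr (fun k => (-1) ^+ g k * tau).

Definition mixture_lr (tau : R) (x : T) : R :=
  2 ^- #|K| * \sum_(g : {ffun K -> bool}) sign_lr tau g x.

Definition coord_lr (tau : R) (k : K) (x : T) : R :=
  \sum_(b : bool) expR ((-1) ^+ b * tau * y k x - tau ^+ 2 / 2) / 2.

(** Independent signs: averaging a product over all sign vectors is the product of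
the averages. *)
Lemma mixture_lr_prod tau x : mixture_lr tau x = \prod_k coord_lr tau k x.
Proof.
rewrite /coord_lr bigA_distr_bigA/= /mixture_lr mulr_sumr.
apply: eq_bigr => g _; rewrite big_split/= prodr_const -exprVn mulrC.
rewrite /sign_lr /shift_lr expR_sum; congr (_ * _).
by apply: eq_bigr => k _; rewrite exprMn sqrr_sign mul1r.
Qed.

Lemma coord_lrE tau k x : coord_lr tau k x =
  expR (- (tau ^+ 2 / 2)) / 2 * (expR (tau * y k x) + expR (- (tau * y k x))).
Proof.
rewrite /coord_lr big_bool/= expr1 expr0 mul1r mulN1r mulNr !expRD.
by field.
Qed.

Lemma coord_lr_gt0 tau k x : 0 < coord_lr tau k x.
Proof. by rewrite coord_lrE mulr_gt0 ?addr_gt0 ?divr_gt0 ?expR_gt0. Qed.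

Lemma mixture_lr_gt0 tau x : 0 < mixture_lr tau x.
Proof. by rewrite mixture_lr_prod prodr_gt0// => k _; exact: coord_lr_gt0. Qed.

Hypothesis my : forall k, measurable_fun setT (y k).
(* The Laplace transform of independent standard Gaussians, normalised. *)
Hypothesis shift_lr1 : forall c, (\int[mu]_x (shift_lr c x)%:E = 1)%E.

Lemma measurable_shift_lr c : measurable_fun setT (shift_lr c).
Proof.
apply: measurableT_comp => //; apply: measurable_sum => k.
by apply: measurable_funB => //; exact: measurable_funM.
Qed.

Lemma measurable_mixture_lr tau : measurable_fun setT (mixture_lr tau).
Proof.
apply: measurable_funM => //; apply: measurable_sum => g.
exact: measurable_shift_lr.
Qed.

Lemma has_integral_shift_lr c : has_integral mu (shift_lr c) 1.
Proof.
split => //; apply/integrableP; split.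
  by apply/measurable_EFinP; exact: measurable_shift_lr.
under eq_integral do rewrite /= ger0_norm ?expR_ge0//.
by rewrite shift_lr1 ltry.
Qed.

(** Multiplying by an exponential of one coordinate completes another square: the
product is a multiple of the likelihood ratio of a further translation. *)
Lemma has_integral_shift_lrM c k b :
  has_integral mu (fun x => shift_lr c x * expR (b * y k x))
    (expR (c k * b + b ^+ 2 / 2)).
Proof.
pose c' j := c j + (j == k)%:R * b.
have H := has_integralZ (expR (c k * b + b ^+ 2 / 2)) (has_integral_shift_lr c').
rewrite mulr1 in H; apply: (eq_has_integral H) => x.
rewrite /shift_lr -!expRD; congr expR.
rewrite (bigD1 k)//= [in RHS](bigD1 k)//= /c' eqxx.
rewrite (eq_bigr (fun j => c j * y j x - c j ^+ 2 / 2)).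
  by rewrite mul1r; field.
by move=> j /negbTE ->; rewrite mul0r addr0.
Qed.

(** The majorant is even in y k, so the sign of the k-th translation does not
matter; the other coordinates integrate to 1.  Everything is a Laurent
polynomial in w = exp (tau^2 / 2). *)
Lemma has_integral_sign_lr_majorant tau g k :
  has_integral mu (fun x => sign_lr tau g x * log_majorant (coord_lr tau k x))
    (kl_rate (tau ^+ 2)).
Proof.
pose h := tau ^+ 2 / 2; pose w := expR h.
have w0 : w != 0 by rewrite gt_eqF// expR_gt0.
pose c j : R := (-1) ^+ g j * tau.
pose m b := has_integral_shift_lrM c k b.
(* Coefficients of the majorant in the exponentials exp (j tau y), |j| <= 3. *)
pose A0 := - (11 / 6) - 3 / 4 * w ^- 2.
pose A1 := 3 / 2 * w ^- 1 + w ^- 3 / 8.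
pose A2 := - (3 / 8) * w ^- 2.
pose A3 := w ^- 3 / 24.
have H := has_integralD (has_integralZ A0 (has_integral_shift_lr c))
  (has_integralD
    (has_integralZ A1 (has_integralD (m tau) (m (- tau))))
    (has_integralD
      (has_integralZ A2 (has_integralD (m (2%:R * tau)) (m (- (2%:R * tau)))))
      (has_integralZ A3 (has_integralD (m (3%:R * tau)) (m (- (3%:R * tau))))))).
apply: has_integral_val; first apply: (eq_has_integral H).
- move=> x; rewrite /sign_lr -/c coord_lrE -/h !mulNr !expRN -!mulrA !expRM_natl.
  rewrite -/w /log_majorant /A0 /A1 /A2 /A3.
  have ? : expR (tau * y k x) != 0 by rewrite gt_eqF// expR_gt0.
  by field; apply/andP; split.
- have e n : expR (n%:R * h) = w ^+ n by rewrite expRM_natl.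
  have eN n : expR (- (n%:R * h)) = w ^- n by rewrite expRN expRM_natl.
  have sq : tau ^+ 2 = 2%:R * h by rewrite /h; field.
  have cases s : s = 1 \/ s = -1 ->
    [/\ expR (s * tau * tau + tau ^+ 2 / 2) +
        expR (s * tau * (- tau) + (- tau) ^+ 2 / 2) = w ^+ 3 + w ^- 1,
        expR (s * tau * (2%:R * tau) + (2%:R * tau) ^+ 2 / 2) +
        expR (s * tau * (- (2%:R * tau)) + (- (2%:R * tau)) ^+ 2 / 2) = w ^+ 8 + 1 &
        expR (s * tau * (3%:R * tau) + (3%:R * tau) ^+ 2 / 2) +
        expR (s * tau * (- (3%:R * tau)) + (- (3%:R * tau)) ^+ 2 / 2) = w ^+ 15 + w ^+ 3].
    have R3 : expR (tau * tau + tau ^+ 2 / 2) = w ^+ 3.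
      by rewrite -e; congr expR; rewrite /h; field.
    have R1 : expR (- (tau * tau) + tau ^+ 2 / 2) = w ^- 1.
      by rewrite -eN; congr expR; rewrite /h; field.
    have R8 : expR (tau * (2%:R * tau) + (2%:R * tau) ^+ 2 / 2) = w ^+ 8.
      by rewrite -e; congr expR; rewrite /h; field.
    have R0 : expR (- (tau * (2%:R * tau)) + (2%:R * tau) ^+ 2 / 2) = 1.
      by rewrite -expR0; congr expR; field.
    have R15 : expR (tau * (3%:R * tau) + (3%:R * tau) ^+ 2 / 2) = w ^+ 15.
      by rewrite -e; congr expR; rewrite /h; field.
    have R3' : expR (- (tau * (3%:R * tau)) + (3%:R * tau) ^+ 2 / 2) = w ^+ 3.
      by rewrite -e; congr expR; rewrite /h; field.
    case=> ->; rewrite ?mul1r ?mulN1r ?mulNr ?mulrN ?opprK !sqrrN R3 R1 R8 R0 R15 R3'//.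
    by split; rewrite addrC.
  rewrite /c; have [|-> -> ->] := cases ((-1) ^+ g k).
    by case: (g k); [right|left].
  rewrite /kl_rate sq.
  rewrite !(mulrA _ 2%:R h) -!natrM.
  rewrite !e !eN /A0 /A1 /A2 /A3.
  by field.
Qed.

Lemma has_integral_mixture_lr tau : has_integral mu (mixture_lr tau) 1.
Proof.
have H := has_integralZ (2 ^- #|K|) (@has_integral_sum _ _ _ _ _ (index_enum {ffun K -> bool})
  _ _ (fun g => has_integral_shift_lr (fun k => (-1) ^+ g k * tau))).
apply: has_integral_val; first exact: (eq_has_integral H).
by rewrite sumr_const card_ffun card_bool -[_ *+ _]mulr_natr mul1r natrX mulVf// expf_neq0.
Qed.

Lemma has_integral_mixture_lr_majorant tau k :
  has_integral mu (fun x => mixture_lr tau x * log_majorant (coord_lr tau k x))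
    (kl_rate (tau ^+ 2)).
Proof.
have H := has_integralZ (2 ^- #|K|) (@has_integral_sum _ _ _ _ _ (index_enum {ffun K -> bool})
  _ _ (fun g => has_integral_sign_lr_majorant tau g k)).
apply: has_integral_val; first apply: (eq_has_integral H).
  by move=> x /=; rewrite /mixture_lr -mulrA mulr_suml.
rewrite sumr_const card_ffun card_bool -(mulr_natr (kl_rate _)) natrX mulrCA mulVf ?mulr1//.
Qed.

(** Fano-type inequality.  With L the mixture ratio, the function
Phi = L (ln L - 1) + 1 is nonnegative and has the divergence as integral; where
L > M one has L <= Phi / (ln M - 1), and elsewhere L <= M.  The logarithm of the
product L is a sum over frequencies, each term of which is replaced by its
polynomial majorant, so that psi below is a majorant of Phi with an explicit
integral. *)
Lemma mixture_lr_le tau (A : set T) M : measurable A -> 0 < M -> 1 < ln M ->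
  (\int[mu]_(x in A) (mixture_lr tau x)%:E <=
   M%:E * mu A + (#|K|%:R * kl_rate (tau ^+ 2) / (ln M - 1))%:E)%E.
Proof.
move=> mA M0 lnM1.
have muAfin : mu A \is a fin_num by exact: fin_num_measure.
pose psi x := \sum_k mixture_lr tau x * log_majorant (coord_lr tau k x) +
  (-1) * mixture_lr tau x + 1.
have Hpsi : has_integral mu psi (#|K|%:R * kl_rate (tau ^+ 2)).
  have H := has_integralD (has_integralD (@has_integral_sum _ _ _ _ _ (index_enum K)
     _ _ (has_integral_mixture_lr_majorant tau))
     (has_integralZ (-1) (has_integral_mixture_lr tau))) (has_integral_cst mu 1).
  apply: has_integral_val; first exact: (eq_has_integral H).
  by rewrite mulr1 addrNK sumr_const mulr_natl.
have lnM0 : 0 < ln M - 1 by rewrite subr_gt0.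
have psi_ge x : mixture_lr tau x * (ln (mixture_lr tau x) - 1) + 1 <= psi x.
  rewrite /psi lerD2r mulrBr mulr1 mulN1r lerD2r -mulr_sumr.
  rewrite ler_pM2l ?mixture_lr_gt0// mixture_lr_prod.
  pose good (u v : R) := 0 < u /\ ln u <= v.
  suff [] : good (\prod_k coord_lr tau k x) (\sum_k log_majorant (coord_lr tau k x)) by [].
  apply: (big_ind2 good).
  - by split; rewrite ?ln1.
  - move=> u1 v1 u2 v2 [u10 h1] [u20 h2]; split; first exact: mulr_gt0.
    by rewrite lnM ?posrE// lerD.
  - by move=> k _; split; [exact: coord_lr_gt0|exact/ln_le_majorant/coord_lr_gt0].
(* ln L >= 1 - 1 / L. *)
have psi0 x : 0 <= psi x.
  apply: le_trans (psi_ge x); have L0 := mixture_lr_gt0 tau x.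
  have L0' : 0 < (mixture_lr tau x)^-1 by rewrite invr_gt0.
  have := @expR_ge1Dx R (ln (mixture_lr tau x)^-1).
  rewrite lnK ?posrE// lnV ?posrE// => h.
  have := ler_wpM2l (ltW L0) h; rewrite divff ?gt_eqF//.
  by rewrite mulrDr mulrN mulrBr mulr1; lra.
have pt x : mixture_lr tau x * \1_A x <= M * \1_A x + (ln M - 1)^-1 * psi x.
  have L0 := mixture_lr_gt0 tau x.
  have c0 : 0 <= (ln M - 1)^-1 * psi x.
    by rewrite mulr_ge0 ?psi0// invr_ge0 ltW.
  have [LM|LM] := leP (mixture_lr tau x) M.
    by rewrite -[leLHS]addr0 lerD// ler_wpM2r.
  apply: (@le_trans _ _ ((ln M - 1)^-1 * psi x)); last first.
    by rewrite lerDr mulr_ge0// ltW.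
  apply: (@le_trans _ _ (mixture_lr tau x)).
    by rewrite ler_piMr ?(ltW L0)// indicE; case: (_ \in _).
  rewrite mulrC ler_pdivlMr//.
  apply: le_trans (psi_ge x); rewrite -[leLHS]addr0 lerD// ler_pM2l// lerD2r.
  by rewrite ler_ln ?posrE// ltW.
have HR := has_integralD (has_integralZ M (has_integral_indic mu mA))
  (has_integralZ (ln M - 1)^-1 Hpsi).
have [_ IR] := HR.
have -> : (M%:E * mu A + (#|K|%:R * kl_rate (tau ^+ 2) / (ln M - 1))%:E)%E =
    (\int[mu]_x (M * \1_A x + (ln M - 1)^-1 * psi x)%:E)%E.
  by rewrite IR EFinD [X in _ = (X + _)%E]EFinM fineK//; congr (_ + _%:E)%E; rewrite mulrC.
rewrite -[in leLHS](setTI A) integral_mkcondr.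
apply: ge0_le_integral => //.
- by move=> x _; rewrite epatch_indic -EFinM lee_fin mulr_ge0// ltW// mixture_lr_gt0.
- rewrite epatch_indic; apply/emeasurable_funM; apply/measurable_EFinP.
    exact: measurable_mixture_lr.
  exact: measurable_indic.
- by have [/integrableP[]] := HR.
- by move=> x _; rewrite epatch_indic -EFinM lee_fin.
Qed.

End mixture.

(** * The block prior *)

Definition ffun_update {I : finType} {X : Type} (F : {ffun I -> X}) (b : I) (t : X) :
  {ffun I -> X} := [ffun c => if c == b then t else F c].

(** Exchanging t with the value of F at b is an involution of the pairs (F, t). *)
Lemma sum_ffun_update (V : nmodType) (I X : finType) (b : I) (G : {ffun I -> X} -> V) :
  \sum_F \sum_t G (ffun_update F b t) = \sum_F G F *+ #|X|.
Proof.
rewrite pair_big/=.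
pose h (p : {ffun I -> X} * X) := (ffun_update p.1 b p.2, p.1 b).
have hK : involutive h.
  move=> [F t]; rewrite /h /=; congr (_, _); last by rewrite ffunE eqxx.
  by apply/ffunP => c; rewrite !ffunE; case: eqP => // ->.
rewrite (reindex_inj (inv_inj hK))/=.
rewrite (eq_bigr (fun p => G p.1)); last first.
  move=> [F t] _ /=; congr G.
  by apply/ffunP => c; rewrite !ffunE; case: eqP => // ->.
rewrite -(pair_big xpredT xpredT (fun F (_ : X) => G F))/=.
by apply: eq_bigr => F _; rewrite sumr_const.
Qed.

Section block_prior.
Context (R : realType) (d s m : nat) (pos : 'I_s -> 'I_m -> 'I_d) (K : finType)
  (iota : K -> int).
Hypothesis pos_inj : forall b i b' i', pos b i = pos b' i' -> b = b' /\ i = i'.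
Hypothesis iota_inj : injective iota.

Local Notation config := {ffun 'I_s -> 'I_m * {ffun K -> bool}}.

Definition active (F : config) (j : 'I_d) : option 'I_s :=
  [pick b | j == pos b (F b).1].

Definition config_support (F : config) : {ffun 'I_d -> bool} :=
  [ffun j => active F j : bool].

(** Inactive coordinates also need a signal of the right radius; all their signs
are +. *)
Definition config_sign (F : config) (j : 'I_d) (k : K) : R :=
  if active F j is Some b then (-1) ^+ (F b).2 k else 1.

Definition config_signal (z : R) (F : config) (j : 'I_d) (l : int) : R :=
  \sum_k (l == iota k)%:R * (config_sign F j k * z).

Definition config_mean (z : R) (F : config) (jl : 'I_d * int) : R :=
  (config_support F jl.1)%:R * config_signal z F jl.1 jl.2.

(** The reference against which position and signs inside block b are tested: it
does not see them, see [null_mean_update]. *)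
Definition null_mean (z : R) (F : config) (b : 'I_s) (jl : 'I_d * int) : R :=
  if [exists i, jl.1 == pos b i] then 0 else config_mean z F jl.

Lemma active_pos F b : active F (pos b (F b).1) = Some b.
Proof.
rewrite /active; case: pickP => [c /eqP /pos_inj [-> //]|/(_ b)].
by rewrite eqxx.
Qed.

Lemma config_mean_split z F b jl : config_mean z F jl =
  null_mean z F b jl +
  \sum_k (jl == (pos b (F b).1, iota k))%:R * ((-1) ^+ (F b).2 k * z).
Proof.
case: jl => j l; rewrite /null_mean /=; case: ifPn => [/existsP[i /eqP ->]|].
- rewrite add0r /config_mean /= ffunE.
  have [->|ne] := eqVneq i (F b).1.
    rewrite active_pos mul1r /config_signal.
    apply: eq_bigr => k _; rewrite /config_sign active_pos.
    by rewrite xpair_eqE eqxx.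
  rewrite big1; last first.
    move=> k _; rewrite xpair_eqE (_ : (_ == _) = false) ?mul0r//.
    by apply: contraNF ne => /eqP /pos_inj[_ ->].
  rewrite (_ : active _ _ = None) ?mul0r// /active; case: pickP => // c /eqP.
  by move=> /pos_inj[bc ie]; move: ne; rewrite ie bc eqxx.
- rewrite negb_exists => /forallP h; rewrite big1 ?addr0// => k _.
  by rewrite xpair_eqE (negbTE (h _)) mul0r.
Qed.

Lemma null_mean_update z F b t jl : null_mean z (ffun_update F b t) b jl = null_mean z F b jl.
Proof.
rewrite /null_mean; case: ifPn => //; rewrite negb_exists => /forallP h.
have E : active (ffun_update F b t) jl.1 = active F jl.1.
  apply: eq_pick => c; rewrite ffunE; case: (eqVneq c b) => [->|//].
  by rewrite (negbTE (h _)) (negbTE (h _)).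
rewrite /config_mean !ffunE E; congr (_ * _).
apply: eq_bigr => k _; rewrite /config_sign E.
case Ea : (active F jl.1) => [c|]//; rewrite ffunE; case: (eqVneq c b) => // cb.
move: Ea; rewrite /active; case: pickP => // c' /eqP jE [c'c].
by have := h (F b).1; rewrite jE c'c cb eqxx.
Qed.

Lemma null_mean0 z F b i l : null_mean z F b (pos b i, l) = 0.
Proof. by rewrite /null_mean ifT//; apply/existsP; exists i. Qed.

Lemma config_support_in F : supports d s (config_support F).
Proof.
rewrite /supports /=.
under eq_bigr do rewrite ffunE.
transitivity (\sum_(j < d | active F j) 1)%N.
  by rewrite [RHS]big_mkcond; apply: eq_bigr => j _; case: active.
rewrite sum1_card.
transitivity #|[seq pos b (F b).1 | b : 'I_s]|.
  apply: eq_card => j; apply/idP/idP => h.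
    have : active F j by exact: h.
    rewrite /active; case: pickP => // b /eqP -> _.
    exact: (fintype.image_f (fun b => pos b (F b).1)).
  by move: h => /fintype.imageP[b _ ->]; rewrite unfold_in active_pos.
by rewrite fintype.card_image ?card_ord// => b c /pos_inj[].
Qed.

End block_prior.

(** * From block identification to the minimax risk *)

Section minimax.
Context (R : realType) (disp : measure_display) (T : measurableType disp)
  (P : probability T R) (d s m : nat) (eps tau : R)
  (xi : 'I_d * int -> {RV P >-> R})
  (pos : 'I_s -> 'I_m -> 'I_d) (K : finType) (iota : K -> int).
Hypothesis eps_gt0 : 0 < eps.
Hypothesis xi_iid : iid_std_normal P xi.
Hypothesis pos_inj : forall b i b' i', pos b i = pos b' i' -> b = b' /\ i = i'.
Hypothesis iota_inj : injective iota.

Local Notation space := (g_sigma_algebraType (cylinders R d)).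
Local Notation config := {ffun 'I_s -> 'I_m * {ffun K -> bool}}.
Local Notation z := (eps * tau).
Local Notation law := (law eps xi).
Implicit Type F : config.

Variable sel : sample R d -> {ffun 'I_d -> bool}.
Hypothesis sel_meas : selectors R d sel.

Definition identified (b : 'I_s) (i : 'I_m) : set space :=
  [set x | forall i', sel x (pos b i') = (i' == i)].

Lemma measurable_identified b i : measurable (identified b i).
Proof.
exact: (sel_meas [set f : {ffun 'I_d -> bool} | forall i', f (pos b i') = (i' == i)]).
Qed.

Lemma identified_inj b i j x : identified b i x -> identified b j x -> i = j.
Proof. by move=> /(_ i) + /(_ i); rewrite eqxx => -> /esym/eqP. Qed.

Definition scaled_coord b i (k : K) (x : space) : R := x (pos b i, iota k) / eps.

Lemma law_null_shift F b i (c : K -> R) (C : set space) : measurable C ->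
  law (fun j => null_mean pos iota z F b j +
    eps * \sum_k (j == (pos b i, iota k))%:R * c k) C =
  (\int[law (null_mean pos iota z F b)]_(x in C) (shift_lr (scaled_coord b i) c x)%:E)%E.
Proof.
move=> mC.
apply: (law_shift xi_iid (iota := fun k => (pos b i, iota k))) => //.
- by rewrite gt_eqF.
- by move=> k k' [] /iota_inj.
- by move=> k; exact: null_mean0.
- exact: index_enum_uniq.
Qed.

Lemma law_config F b (C : set space) : measurable C ->
  law (config_mean pos iota z F) C =
  (\int[law (null_mean pos iota z F b)]_(x in C)
     (sign_lr (scaled_coord b (F b).1) tau (F b).2 x)%:E)%E.
Proof.
move=> mC; rewrite -law_null_shift//; congr (law _ C).
apply/funext => j; rewrite (config_mean_split iota pos_inj _ F b); congr (_ + _).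
by rewrite mulr_sumr; apply: eq_bigr => k _; ring.
Qed.

(** The configuration outside block b is fixed.  The sum over the signs turns the
translated laws into 2^|K| times the mixture, and the sum over the positions
uses that the events are disjoint. *)
Lemma law_block_success F b M : 0 < M -> 1 < ln M ->
  \sum_(t : 'I_m * {ffun K -> bool})
    fine (law (config_mean pos iota z (ffun_update F b t)) (identified b t.1)) <=
  2 ^+ #|K| * (M + m%:R * (#|K|%:R * kl_rate (tau ^+ 2) / (ln M - 1))).
Proof.
move=> M0 lnM.
set mu := law (null_mean pos iota z F b).
have mId i := measurable_identified b i.
have mc i k : measurable_fun setT (scaled_coord b i k).
  by apply: measurable_funM => //; exact: measurable_coord.
have lr1 i c : (\int[mu]_x (shift_lr (scaled_coord b i) c x)%:E = 1)%E.
  by rewrite -law_null_shift//; exact: probability_setT.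
pose I i g := (\int[mu]_(x in identified b i) (sign_lr (scaled_coord b i) tau g x)%:E)%E.
have IE i g : I i g = law (config_mean pos iota z (ffun_update F b (i, g))) (identified b i).
  rewrite (@law_config _ b)// ffunE eqxx /I /mu.
  rewrite (_ : null_mean pos iota z (ffun_update F b (i, g)) b = null_mean pos iota z F b)//.
  by apply/funext => j; exact: null_mean_update.
have Ifin i g : I i g \is a fin_num by rewrite IE; exact: fin_num_measure.
have mS i g : measurable_fun setT (sign_lr (scaled_coord b i) tau g).
  exact: measurable_shift_lr.
have mixE i : (\int[mu]_(x in identified b i) (mixture_lr (scaled_coord b i) tau x)%:E =
    (2 ^- #|K| * \sum_g fine (I i g))%:E)%E.
  under eq_integral do rewrite /mixture_lr EFinM -sumEFin.
  rewrite ge0_integralZl//; last 2 first.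
  - by apply: emeasurable_sum => g; apply/measurable_funTS/measurable_EFinP.
  - by move=> x _; apply: sume_ge0 => g _; rewrite lee_fin expR_ge0.
  rewrite ge0_integral_sum//; last 2 first.
  - by move=> g; apply/measurable_funTS/measurable_EFinP.
  - by move=> g x _; rewrite lee_fin expR_ge0.
  rewrite EFinM -sumEFin; congr (_ * _)%E.
  by apply: eq_bigr => g _; rewrite fineK.
have mix_le i : \sum_g fine (I i g) <= 2 ^+ #|K| *
    (M * fine (mu (identified b i)) + #|K|%:R * kl_rate (tau ^+ 2) / (ln M - 1)).
  have := mixture_lr_le (mc i) (lr1 i) tau (mId i) M0 lnM.
  rewrite mixE -[mu _]fineK ?fin_num_measure// -EFinM -EFinD lee_fin => h.
  have p0 : (0 : R) < 2 ^+ #|K| by rewrite exprn_gt0.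
  by rewrite -ler_pdivrMl.
rewrite (eq_bigr (fun t => fine (I t.1 t.2))); last first.
  by move=> [i g] _; rewrite IE.
rewrite -(pair_bigA _ (fun i g => fine (I i g)))/=.
apply: (le_trans (ler_sum _ (fun i _ => mix_le i))).
rewrite -mulr_sumr ler_wpM2l ?exprn_ge0// big_split/= -mulr_sumr sumr_const card_ord.
rewrite -[X in _ + X <= _]mulr_natl lerD2r ler_piMr ?(ltW M0)//.
by apply: sum_disjoint_le1 => //; exact: identified_inj.
Qed.

(** Resampling one block leaves the uniform prior invariant. *)
Lemma average_success b M : 0 < M -> 1 < ln M -> (0 < m)%N ->
  \sum_F fine (law (config_mean pos iota z F) (identified b (F b).1)) <=
  #|{: config}|%:R * (M / m%:R + #|K|%:R * kl_rate (tau ^+ 2) / (ln M - 1)).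
Proof.
move=> M0 lnM m0.
pose G F := fine (law (config_mean pos iota z F) (identified b (F b).1)).
have := sum_ffun_update b G.
rewrite sumrMnl card_prod card_ord card_ffun card_bool => GE.
have mR0 : (0 : R) < m%:R by rewrite ltr0n.
have p0 : (0 : R) < (m * 2 ^ #|K|)%:R by rewrite natrM natrX mulr_gt0 ?exprn_gt0.
change (\sum_F G F <=
  #|{: config}|%:R * (M / m%:R + #|K|%:R * kl_rate (tau ^+ 2) / (ln M - 1))).
rewrite -(ler_pM2l p0) [leLHS]mulr_natl -GE.
apply: (@le_trans _ _ (\sum_(F : config)
   2 ^+ #|K| * (M + m%:R * (#|K|%:R * kl_rate (tau ^+ 2) / (ln M - 1))))).
  apply: ler_sum => F _; apply: le_trans (law_block_success F b M0 lnM).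
  rewrite le_eqVlt; apply/orP; left; apply/eqP.
  by apply: eq_bigr => t _; rewrite /G ffunE eqxx.
rewrite sumr_const -[leLHS]mulr_natl natrM natrX le_eqVlt; apply/orP; left; apply/eqP.
by field; rewrite !gt_eqF// subr_gt0.
Qed.

Lemma config_support_pos F b i :
  config_support pos F (pos b i) = (i == (F b).1) :> bool.
Proof.
rewrite ffunE; have [->|ne] := eqVneq i (F b).1; first by rewrite (active_pos pos_inj).
rewrite /active; case: pickP => // c /eqP /pos_inj[bc ie].
by move: ne; rewrite ie bc eqxx.
Qed.

(** A block in which the selector differs from the indicator of the active
position costs at least 1. *)
Lemma hamming_ge F x :
  \sum_b (1 - \1_(identified b (F b).1) x) <=
  hamming (config_support pos F) (sel x) :> R.
Proof.
pose h j : R := `|(config_support pos F j)%:R - (sel x j)%:R|.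
have -> : hamming (config_support pos F) (sel x) = \sum_j h j by [].
pose phi (p : 'I_s * 'I_m) := pos p.1 p.2.
have phi_inj : injective phi.
  by move=> [b i] [b' i'] /pos_inj /= [-> ->].
apply: (@le_trans _ _ (\sum_(j in phi @: xpredT) h j)); last first.
  rewrite [leRHS](bigID (fun j => j \in phi @: xpredT))/= lerDl.
  by apply: sumr_ge0 => j _; exact: normr_ge0.
rewrite big_imset/=; last by move=> p q _ _; exact: phi_inj.
rewrite (eq_bigl xpredT)//.
rewrite -(pair_bigA _ (fun b i => h (pos b i)))/=.
apply: ler_sum => b _; rewrite indicE.
have [/set_mem xA|xA] := boolP (x \in identified b (F b).1).
  by rewrite subrr sumr_ge0// => i _; exact: normr_ge0.
rewrite subr0.
have [i ne] : exists i, sel x (pos b i) != (i == (F b).1).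
  apply/existsP; apply: contraNT xA; rewrite negb_exists => /forallP al.
  by apply/mem_set => i; apply/eqP; rewrite -[_ == _]negbK; exact: al.
rewrite (bigD1 i)//= (@le_trans _ _ (h (pos b i)))//.
  rewrite /h config_support_pos; case: (i == _) ne; case: (sel x _) => // _;
  by rewrite ?subr0 ?sub0r ?normrN normr1.
by rewrite lerDl sumr_ge0// => i' _; exact: normr_ge0.
Qed.

Lemma measurable_hamming F (mean : 'I_d * int -> R) : measurable_fun setT
  (fun w => hamming (config_support pos F) (sel (obs eps xi mean w)) : R).
Proof.
apply: (measurableT_comp (f := fun x : space =>
  hamming (config_support pos F) (sel x) : R)); last exact: measurable_obs.
apply: measurable_sum => j; apply: measurableT_comp => //.
apply: measurable_funB => //.
rewrite (_ : (fun _ => _) = \1_(sel @^-1` [set f : {ffun 'I_d -> bool} | f j])).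
  apply: measurable_indic; exact: sel_meas.
by apply/funext => x; rewrite indicE; congr ((nat_of_bool _)%:R); apply/idP/idP;
  [move/mem_set|move/set_mem].
Qed.

Lemma expected_hamming_ge F :
  ((\sum_b (1 - fine (law (config_mean pos iota z F) (identified b (F b).1))))%:E <=
   'E_P[(fun w => hamming (config_support pos F) (sel (observation eps
     (config_support pos F) (config_signal pos iota z F) xi w)))])%E.
Proof.
pose A b := obs eps xi (config_mean pos iota z F) @^-1` identified b (F b).1.
have mA b : measurable (A b).
  rewrite -[A b]setTI; apply: measurable_obs => //; exact: measurable_identified.
have HR := @has_integral_sum _ _ _ P _ (index_enum 'I_s) _ _ (fun b =>
  has_integralD (has_integral_cst P 1) (has_integralZ (-1) (has_integral_indic P (mA b)))).
have [_ IR] := HR.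
have -> : \sum_b (1 - fine (law (config_mean pos iota z F) (identified b (F b).1))) =
    \sum_b (1 + -1 * fine (P (A b))).
  by apply: eq_bigr => b _; rewrite mulN1r.
rewrite -IR expectation.unlock; apply: ge0_le_integral => //=.
- move=> w _; rewrite lee_fin; apply: sumr_ge0 => b _.
  by rewrite mulN1r subr_ge0 indicE lern1 leq_b1.
- by have [/integrableP[]] := HR.
- by apply/measurable_EFinP; exact: (measurable_hamming F (config_mean pos iota z F)).
- move=> w _; rewrite lee_fin.
  apply: le_trans (hamming_ge F (obs eps xi (config_mean pos iota z F) w)).
  by apply: ler_sum => b _; rewrite mulN1r.
Qed.

(** Were the loss below the bound for every configuration, so would be its average
over the uniform prior. *)
Lemma exists_hard_config M : 0 < M -> 1 < ln M -> (0 < m)%N -> (0 < s)%N ->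
  exists F, 1 - (M / m%:R + #|K|%:R * kl_rate (tau ^+ 2) / (ln M - 1)) <=
    s%:R^-1 * \sum_b (1 - fine (law (config_mean pos iota z F) (identified b (F b).1))).
Proof.
move=> M0 lnM m0 s0; set succ := M / m%:R + _.
apply/not_existsP => H.
have sR0 : (0 : R) < s%:R by rewrite ltr0n.
pose p F b := fine (law (config_mean pos iota z F) (identified b (F b).1)).
have lt F : \sum_b (1 - p F b) < s%:R * (1 - succ).
  have /negP := H F; rewrite -ltNge mulrC ltr_pdivrMr//.
  by rewrite [_ * s%:R]mulrC.
have F0 : config by exact: [ffun=> (Ordinal m0, [ffun=> false])].
have c0 : (0 < #|{: config}|)%N by apply/card_gt0P; exists F0.
have : \sum_F \sum_b (1 - p F b) < \sum_(F : config) s%:R * (1 - succ).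
  apply: ltr_sum => //.
  by apply/hasP; exists F0; rewrite ?mem_index_enum.
rewrite exchange_big/= sumr_const.
have : \sum_(b < s) #|{: config}|%:R * (1 - succ) <= \sum_(b < s) \sum_F (1 - p F b).
  apply: ler_sum => b _; rewrite sumrB sumr_const mulrBr mulr1 lerB//.
  exact: average_success.
rewrite sumr_const card_ord => /le_lt_trans/[apply].
by rewrite -[ltLHS]mulr_natl -[ltRHS]mulr_natl mulrCA ltxx.
Qed.

End minimax.

Lemma minimax_risk_ge_fano (R : realType) (disp : measure_display) (T : measurableType disp)
  (P : probability T R) (d s m : nat) (sigma eps r tau M : R)
  (xi : 'I_d * int -> {RV P >-> R})
  (pos : 'I_s -> 'I_m -> 'I_d) (K : finType) (iota : K -> int) :
  0 < eps -> iid_std_normal P xi ->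
  (forall b i b' i', pos b i = pos b' i' -> b = b' /\ i = i') -> injective iota ->
  (0 < m)%N -> (0 < s)%N -> 0 < M -> 1 < ln M ->
  (forall g : K -> bool, Theta sigma r
     (fun l => \sum_k (l == iota k)%:R * ((-1) ^+ g k * (eps * tau)))) ->
  ((1 - (M / m%:R + #|K|%:R * kl_rate (tau ^+ 2) / (ln M - 1)))%:E <=
   minimax_risk P sigma eps r d s xi)%E.
Proof.
move=> eps0 iid pinj iinj m0 s0 M0 lnM HTheta.
apply/ereal_infP => _ [sel selm <-].
have [F HF] := @exists_hard_config R disp T P d s m eps tau xi pos K iota eps0 iid
  pinj iinj sel selm M M0 lnM m0 s0.
apply: le_ereal_sup_tmp.
eexists; first by exists (config_support pos F) => //; exact: config_support_in.
apply: le_ereal_sup_tmp.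
eexists.
  exists (config_signal pos iota (eps * tau) F) => //.
  move=> j; rewrite /config_signal /config_sign.
  case: (active pos F j) => [b|]; first exact: (HTheta (F b).2).
  exact: (HTheta (fun _ => false)).
have HE := expected_hamming_ge eps tau xi iota pinj selm F.
apply: (@le_trans _ _ ((s%:R^-1)%:E * (\sum_b (1 - fine (law eps xi
  (config_mean pos iota (eps * tau) F) (identified pos sel b (F b).1))))%:E)%E).
  by rewrite -EFinM lee_fin.
by rewrite lee_wpmul2l// lee_fin invr_ge0 ler0n.
Qed.

(** * Flat signals in the analytic ellipsoid *)

Section esum_tools.
Context (R : realType).

Lemma esum_finite_support (I : choiceType) (K : finType) (iota : K -> I) (f : I -> R) :
  injective iota -> (forall i, 0 <= f i) ->
  (forall i, (forall k, i != iota k) -> f i = 0) ->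
  (\esum_(i in [set: I]) (f i)%:E = (\sum_k f (iota k))%:E)%E.
Proof.
move=> inj f0 f00.
transitivity (\esum_(i in [set iota k | k in [set: K]]) (f i)%:E)%E.
  rewrite [RHS]esum_mkcond; apply: eq_esum => i _; case: ifPn => // ni.
  rewrite f00// => k; apply: contraNneq ni => ->.
  by apply/mem_set; exists k.
rewrite esum_image; last by move=> x y _ _; exact: inj.
rewrite esum_fset; last 2 first.
- exact: finite_finset.
- by move=> k _; rewrite lee_fin.
rewrite -sumEFin (_ : [set: K] = [set` index_enum K]).
  by rewrite -fsbig_seq// index_enum_uniq.
by apply/seteqP; split => // k _ /=; exact: mem_index_enum.
Qed.

Lemma esumZ_le (I : choiceType) (c B : R) (f : I -> R) :
  0 <= c -> (\esum_(i in [set: I]) (f i)%:E <= B%:E)%E ->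
  (\esum_(i in [set: I]) (c * f i)%:E <= (c * B)%:E)%E.
Proof.
move=> c0 h; apply: ge_ereal_sup => _ [A [Afin _] <-].
rewrite fsbig_finite//= sumEFin lee_fin -mulr_sumr ler_wpM2l// -lee_fin -sumEFin.
apply: le_trans h; rewrite -fsbig_finite//; apply: ereal_sup_ubound.
by exists A.
Qed.

End esum_tools.

Section signal.
Context (R : realType).
Implicit Types sigma r eps : R.

(** The nonzero frequencies of modulus at most M; recall that Negz i is - i.+1. *)
Definition freq (M : nat) (k : 'I_M * bool) : int :=
  if k.2 then Posz k.1.+1 else Negz k.1.

Lemma freq_inj M : injective (@freq M).
Proof. by move=> [i []] [j []] //= [] /val_inj ->. Qed.

Lemma freq_neq0 M (k : 'I_M * bool) : 0 != freq k.
Proof. by case: k => i []. Qed.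

Lemma abs_freq M (k : 'I_M * bool) : `|(freq k)%:~R| = (k.1.+1)%:R :> R.
Proof.
case: k => i [] /=; first by rewrite /freq/= ger0_norm ?ler0z.
by rewrite /freq/= NegzE rmorphN/= normrN ger0_norm ?ler0z.
Qed.

Lemma freq_covers M (l : int) : (0 < `|l| <= M)%N -> exists k : 'I_M * bool, l = freq k.
Proof.
case: l => [[//|n]|n] /= h; first by exists (Ordinal h, true).
by exists (Ordinal h, false).
Qed.

Lemma analytic_coef_freq_le sigma M (k : 'I_M * bool) : 0 < sigma ->
  analytic_coef sigma (freq k) <= expR (2 * pi * sigma * M%:R).
Proof.
move=> s0; rewrite /analytic_coef ler_expR abs_freq ler_wpM2l ?ler_nat//.
by rewrite !mulr_ge0 ?pi_ge0// ltW.
Qed.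

Lemma flat_signal_Theta sigma r z M (g : 'I_M * bool -> bool) : 0 < sigma ->
  M.*2%:R * z ^+ 2 * expR (2 * pi * sigma * M%:R) ^+ 2 <= 1 ->
  r ^+ 2 <= M.*2%:R * z ^+ 2 ->
  Theta sigma r (fun l => \sum_k (l == freq k)%:R * ((-1) ^+ g k * z)).
Proof.
move=> s0 ell rad.
set v := fun l : int => _.
have vE (k : 'I_M * bool) : v (freq k) = (-1) ^+ g k * z.
  rewrite /v (bigD1 k)//= eqxx mul1r big1 ?addr0// => k' k'k.
  by rewrite (inj_eq (@freq_inj M)) eq_sym (negbTE k'k) mul0r.
have v0 l : (forall k, l != @freq M k) -> v l = 0.
  by move=> h; rewrite /v big1// => k _; rewrite (negbTE (h k)) mul0r.
have v2 (k : 'I_M * bool) : v (freq k) ^+ 2 = z ^+ 2 by rewrite vE exprMn sqrr_sign mul1r.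
have card : #|{: 'I_M * bool}| = M.*2 by rewrite card_prod card_ord card_bool muln2.
have Ev2 : (\esum_(l in [set: int]) (v l ^+ 2)%:E = (M.*2%:R * z ^+ 2)%:E)%E.
  rewrite (esum_finite_support (@freq_inj M)).
  - by under eq_bigr do rewrite v2; rewrite sumr_const card mulr_natl.
  - by move=> l; exact: sqr_ge0.
  - by move=> l /v0 ->; rewrite expr0n.
split.
- by rewrite Ev2 ltry.
- by apply: v0 => k; exact: freq_neq0.
- rewrite (esum_finite_support (@freq_inj M)).
  + rewrite lee_fin; apply: le_trans ell.
    rewrite -card -mulrA mulr_natl -[X in _ <= X]sumr_const.
    apply: ler_sum => k _; rewrite v2 mulrC ler_wpM2l ?sqr_ge0//.
    by rewrite ler_sqr ?nnegrE ?expR_ge0// analytic_coef_freq_le.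
  + by move=> l; rewrite mulr_ge0 ?sqr_ge0.
  + by move=> l /v0 ->; rewrite expr0n mulr0.
- by rewrite Ev2 lee_fin.
Qed.

(** Young's inequality v^2 <= q/2 + v^4/(2q) on the 2N nonzero frequencies of
modulus at most N replaces Cauchy-Schwarz; beyond N the ellipsoid weight is at
least exp (2 pi sigma N)^2, and the constraint bounds the energy. *)
Lemma radius_le sigma r (S q : R) (N : nat) (v : int -> R) : 0 < sigma -> 0 < q ->
  Theta sigma r v -> (\esum_(l in [set: int]) (v l ^+ 4)%:E <= S%:E)%E ->
  r ^+ 2 <= N%:R * q + S / (2 * q) + expR (- (2 * pi * sigma * N%:R)) ^+ 2.
Proof.
move=> s0 q0 [_ v0 ell rad] h4.
set C := expR (- (2 * pi * sigma * N%:R)) ^+ 2.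
rewrite -lee_fin; apply: le_trans rad _.
pose ind (l : int) : R := [exists k : 'I_N * bool, l == freq k]%:R.
pose f1 l := q / 2 * ind l.
pose f2 l := (2 * q)^-1 * v l ^+ 4.
pose f3 l := C * (analytic_coef sigma l ^+ 2 * v l ^+ 2).
have p1 l : 0 <= f1 l by rewrite mulr_ge0 ?divr_ge0 ?(ltW q0)// ler0n.
have p2 l : 0 <= f2 l.
  by apply: mulr_ge0; [rewrite invr_ge0 mulr_ge0 ?(ltW q0)|exact: exprn_even_ge0].
have p3 l : 0 <= f3 l.
  by apply: mulr_ge0; [exact: sqr_ge0|apply: mulr_ge0; exact: sqr_ge0].
apply: (@le_trans _ _ (\esum_(l in [set: int]) ((f1 l)%:E + ((f2 l)%:E + (f3 l)%:E)))%E).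
  apply: le_esum => l _; rewrite -!EFinD lee_fin.
  have [->|l0] := eqVneq l 0.
    by rewrite v0 expr0n/= !addr_ge0.
  have [lN|lN] := leqP `|l|%N N.
    have [k lk] : exists k : 'I_N * bool, l = freq k.
      by apply: freq_covers; rewrite lN absz_gt0 l0.
    have ind1 : ind l = 1.
      by rewrite /ind (_ : [exists _, _] = true)//; apply/existsP; exists k; rewrite lk.
    rewrite addrA -[leLHS]addr0 lerD// /f1 /f2 ind1 mulr1.
    have -> : q / 2 + (2 * q)^-1 * v l ^+ 4 = v l ^+ 2 + (2 * q)^-1 * (v l ^+ 2 - q) ^+ 2.
      by field; rewrite gt_eqF.
    by rewrite lerDl mulr_ge0 ?sqr_ge0// invr_ge0 mulr_ge0// ltW.
  rewrite -[leLHS]add0r lerD// -[leLHS]add0r lerD// /f3 mulrA.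
  rewrite -[leLHS]mul1r ler_wpM2r ?sqr_ge0// /C -exprMn exprn_ege1//.
  rewrite /analytic_coef -expRD -[leLHS]expR0 ler_expR addrC subr_ge0 ler_wpM2l//.
    by rewrite !mulr_ge0 ?pi_ge0// ltW.
  have -> : `|l%:~R| = `|l|%N%:R :> R by rewrite pmulrn abszE intr_norm.
  by rewrite ler_nat ltnW.
rewrite esumD; last 2 first.
- by move=> l _; rewrite lee_fin.
- by move=> l _; rewrite adde_ge0// lee_fin.
rewrite esumD; last 2 first.
- by move=> l _; rewrite lee_fin.
- by move=> l _; rewrite lee_fin.
rewrite !EFinD -addeA; apply: leeD; last apply: leeD.
- rewrite (esum_finite_support (@freq_inj N)) ?lee_fin.
  + rewrite (eq_bigr (fun _ => q / 2)); last first.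
      move=> k _; rewrite /f1 /ind (_ : [exists _, _] = true) ?mulr1//.
      by apply/existsP; exists k.
    rewrite sumr_const card_prod card_ord card_bool -[leLHS]mulr_natl natrM.
    by rewrite le_eqVlt; apply/orP; left; apply/eqP; field.
  + exact: p1.
  + move=> l h; rewrite /f1 /ind (_ : [exists _, _] = false) ?mulr0//.
    by apply/negbTE; rewrite negb_exists; apply/forallP.
- rewrite mulrC; apply: esumZ_le => //.
  by rewrite invr_ge0 mulr_ge0// ltW.
- rewrite -[C]mulr1; apply: esumZ_le => //.
  exact: sqr_ge0.
Qed.

End signal.

(** * The bound at a fixed noise level *)

Section fixed_noise.
Context (R : realType).
Implicit Types sigma q p t b L x : R.

Lemma kl_rate_small b t : b <= 1 -> 0 <= t -> t <= b / 200 ->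
  kl_rate t <= t ^+ 2 / 4 * (1 + b).
Proof.
move=> b1 t0 tb.
have t1 : t <= 1 / 200 by lra.
pose v := expR t - 1.
have v0 : 0 <= v by rewrite subr_ge0 -expR0 ler_expR.
have vt : v <= t * (1 + 2 * t).
  have e0 : 0 < expR t by exact: expR_gt0.
  have := expR_ge1Dx (- t); rewrite expRN.
  move=> /(ler_wpM2r (ltW e0)); rewrite mulVf ?gt_eqF// => h.
  have h2 : 1 <= (1 + 2 * t) * (1 - t) by nra.
  by rewrite /v; nra.
have tt : 0 <= t * (1 + 2 * t) by nra.
have v1 : v <= 1 by apply: le_trans vt _; nra.
apply: le_trans (kl_rate_le t0 erefl v1) _; rewrite -/v.
set y := t * (1 + 2 * t) in vt tt.
have y2 : v ^+ 2 <= y ^+ 2 by rewrite ler_sqr// nnegrE.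
have yt : y <= 21 / 20 * t by rewrite /y; nra.
apply: (@le_trans _ _ (y ^+ 2 / 4 * (1 + 21 * t))).
  have : v ^+ 2 * (1 + 20 * v) <= y ^+ 2 * (1 + 21 * t).
    by apply: ler_pM => //; [exact: sqr_ge0|lra|lra].
  by rewrite !exprS; lra.
have -> : y ^+ 2 = t ^+ 2 * (1 + 2 * t) ^+ 2 by rewrite /y exprMn.
rewrite -!mulrA ler_wpM2l ?sqr_ge0//.
by nra.
Qed.

(** With l = ln (1/eps) / w and w = 2 pi sigma, the flat signal occupies
M = (1 - a/4) l frequencies on each side, and the radius of v is estimated with
the cutoff N = l + O(1) and with q equal to the squared amplitude eps^2 t.  The
loss from M to N and the energy eps^2 beyond N are absorbed by
a = (1 - q/p) / 2, half of the relative gap between q and p. *)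
Lemma flat_signal_exists sigma q p t0 : 0 < sigma -> 0 < q -> q < p -> p <= 1 ->
  0 < t0 -> t0 <= 1 ->
  exists X0 gamma : R, 0 < gamma /\
  forall (eps r L : R) (v : int -> R), 0 < eps -> X0 <= ln eps^-1 -> 1 <= L ->
    L <= gamma * ln eps^-1 -> Theta sigma r v ->
    (\esum_(l in [set: int]) (v l ^+ 4)%:E <= (4 * eps ^+ 4 * q * L)%:E)%E ->
  exists (M : nat) (t : R), [/\ 0 < t, t <= t0, M.*2%:R * t ^+ 2 = 4 * p * L,
    M.*2%:R * (eps ^+ 2 * t) * expR (2 * pi * sigma * M%:R) ^+ 2 <= 1 &
    r ^+ 2 <= M.*2%:R * (eps ^+ 2 * t)].
Proof.
move=> s0 q0 qp p1 t00 t01.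
have p0 : 0 < p by exact: lt_trans qp.
have [w wE] : exists w : R, w = 2 * pi * sigma by exists (2 * pi * sigma).
have w0 : 0 < w by rewrite wE !mulr_gt0 ?pi_gt0.
rewrite -wE.
have [a aE] : exists a : R, a = (1 - q / p) / 2 by exists ((1 - q / p) / 2).
have qp1 : q / p < 1 by rewrite ltr_pdivrMr// mul1r.
have qp0 : 0 < q / p by rewrite divr_gt0.
have a0 : 0 < a by rewrite aE; lra.
have a1 : a < 1 / 2 by rewrite aE; lra.
have [dl dlE] : exists dl : R, dl = a / 4 by exists (a / 4).
have dl0 : 0 < dl by rewrite dlE; lra.
(* One summand for each lower bound on l needed below. *)
pose l0 := 8 + 6 / a + (p * a ^+ 2)^-1 + ((dl * w) ^+ 2)^-1.
exists (w * l0), (t0 ^+ 2 / (4 * p * w)); split.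
  by apply: divr_gt0; [exact: exprn_gt0|apply: mulr_gt0 => //; exact: mulr_gt0].
move=> eps r L v eps0 xX0 L1 Lx Tv S4.
set x := ln eps^-1 in xX0 Lx.
have epsE : eps = expR (- x) by rewrite expRN /x lnK ?invrK// posrE invr_gt0.
pose l := x / w.
have xE : x = w * l by rewrite /l mulrC divfK ?gt_eqF.
have ll0 : l0 <= l by rewrite /l ler_pdivlMr// mulrC.
have i1 : 0 < 6 / a by rewrite divr_gt0.
have i2 : 0 < (p * a ^+ 2)^-1 by rewrite invr_gt0 mulr_gt0 ?exprn_gt0.
have i3 : 0 < ((dl * w) ^+ 2)^-1 by rewrite invr_gt0 exprn_gt0 ?mulr_gt0.
have l8 : 8 <= l by apply: le_trans ll0; rewrite /l0; lra.
have la : 6 / a <= l by apply: le_trans ll0; rewrite /l0; lra.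
have lpa : (p * a ^+ 2)^-1 <= l by apply: le_trans ll0; rewrite /l0; lra.
have ldw : ((dl * w) ^+ 2)^-1 <= l by apply: le_trans ll0; rewrite /l0; lra.
pose M := Num.truncn ((1 - dl) * l).
pose N := (Num.truncn l).+1.
have l00 : 0 <= l by lra.
have dll0 : 0 <= (1 - dl) * l by rewrite mulr_ge0// dlE; lra.
have /andP[M1 M2] : (M%:R <= (1 - dl) * l < M.+1%:R) by exact: truncn_itv.
have /andP[N1 N2] : ((Num.truncn l)%:R <= l < N%:R) by exact: truncn_itv.
have NE : N%:R = (Num.truncn l)%:R + 1 :> R by rewrite /N -natr1.
rewrite -natr1 in M2.
have al6 : 6 <= a * l by rewrite mulrC -ler_pdivrMr.
have Ml : l / 2 <= M%:R by move: M2; rewrite dlE; nra.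
have M0 : 0 < M%:R :> R by lra.
have MM : M.*2%:R = 2 * M%:R :> R by rewrite -muln2 natrM mulrC.
have pLM0 : 0 < 2 * p * L / M%:R.
  by apply: divr_gt0 => //; rewrite mulr_gt0 ?mulr_gt0// (lt_le_trans ltr01 L1).
pose t := Num.sqrt (2 * p * L / M%:R).
have t2 : t ^+ 2 = 2 * p * L / M%:R.
  by rewrite sqr_sqrtr// ltW.
have Mt2 : M%:R * t ^+ 2 = 2 * p * L by rewrite t2 mulrC divfK ?gt_eqF.
have t_gt0 : 0 < t by rewrite sqrtr_gt0.
have tt0 : t <= t0.
  rewrite -ler_sqr ?nnegrE ?(ltW t_gt0) ?(ltW t00)// t2 ler_pdivrMr//.
  have h : L * (4 * p * w) <= t0 ^+ 2 * (w * l).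
    by rewrite -xE -ler_pdivlMr ?mulr_gt0// mulrAC.
  have : L * (4 * p) <= t0 ^+ 2 * l.
    by rewrite -(ler_pM2r w0) -mulrA [leRHS]mulrAC -[leRHS]mulrA.
  have := sqr_ge0 t0; nra.
exists M, t; split => //.
- by rewrite MM -mulrA Mt2; ring.
- have -> : M.*2%:R * (eps ^+ 2 * t) * expR (w * M%:R) ^+ 2 =
      2 * M%:R * t * (eps * expR (w * M%:R)) ^+ 2 by rewrite MM; ring.
  have h1 : eps * expR (w * M%:R) <= expR (- (dl * w * l)).
    rewrite epsE -expRD ler_expR xE.
    by move: (ler_wpM2l (ltW w0) M1); clear; lra.
  have h2 : (eps * expR (w * M%:R)) ^+ 2 <= expR (- (dl * w * l)) ^+ 2.
    by rewrite ler_sqr ?nnegrE ?mulr_ge0 ?expR_ge0// ltW.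
  have h3 : 2 * l * expR (- (dl * w * l)) ^+ 2 <= 1.
    rewrite expRN exprVn ler_pdivrMr ?exprn_gt0 ?expR_gt0// mul1r.
    rewrite -expRM_natl.
    have y0 : 0 <= 2%:R * (dl * w * l).
      by apply: mulr_ge0; [rewrite ler0n|exact: mulr_ge0 (ltW (mulr_gt0 dl0 w0)) l00].
    apply: le_trans (expR_ge1Dxn 1 y0).
    have : 1 <= l * (dl * w) ^+ 2.
      by rewrite -ler_pdivrMr ?exprn_gt0 ?mulr_gt0// mul1r.
    have -> : (2%:R * (dl * w * l)) ^+ 2 / 2`!%:R = 2 * (l * (dl * w) ^+ 2) * l.
      by rewrite (_ : (2`!)%N = 2%N)//; field.
    nra.
  apply: le_trans h3; apply: ler_pM => //.
  + by rewrite !mulr_ge0 ?(ltW M0) ?(ltW t_gt0).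
  + exact: sqr_ge0.
  + have ? : M%:R <= l by move: M1; rewrite dlE; nra.
    have ? : t <= 1 by exact: le_trans tt0 t01.
    nra.
- have e2 : 0 < eps ^+ 2 by rewrite exprn_gt0.
  have q'0 : 0 < eps ^+ 2 * t by rewrite mulr_gt0.
  have := radius_le N s0 q'0 Tv S4; rewrite -wE => /le_trans; apply.
  have h1 : expR (- (w * N%:R)) ^+ 2 <= eps ^+ 2.
    rewrite ler_sqr ?nnegrE ?expR_ge0 ?(ltW eps0)// epsE ler_expR lerN2 xE.
    by rewrite ler_wpM2l// ltW.
  have h2 : 4 * eps ^+ 4 * q * L / (2 * (eps ^+ 2 * t)) = eps ^+ 2 * (q / p * M%:R * t).
    have -> : q / p * M%:R * t = q / p * (M%:R * t ^+ 2) / t.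
      by field; rewrite !gt_eqF.
    by rewrite Mt2; field; rewrite !gt_eqF.
  rewrite h2 mulrCA [leRHS]mulrCA.
  have h3 : N%:R <= (1 + a) * M%:R.
    by rewrite NE; move: M2 N1; rewrite dlE; nra.
  (* The energy beyond N, at most eps^2, is paid by a fraction a of the flat one. *)
  have h4 : 1 <= a * M%:R * t.
    rewrite -ler_sqr ?nnegrE//; last first.
      exact: mulr_ge0 (mulr_ge0 (ltW a0) (ltW M0)) (ltW t_gt0).
    rewrite expr1n.
    have -> : (a * M%:R * t) ^+ 2 = 2 * (a ^+ 2 * p) * M%:R * L.
      have -> : (a * M%:R * t) ^+ 2 = a ^+ 2 * M%:R * (M%:R * t ^+ 2) by ring.
      by rewrite Mt2; ring.
    have h5 : 1 <= a ^+ 2 * p * l.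
      by rewrite mulrC -ler_pdivrMr ?mulr_gt0 ?exprn_gt0// mul1r [_ * p]mulrC.
    have : 1 <= 2 * (a ^+ 2 * p) * M%:R.
      have ap : 0 < a ^+ 2 * p by rewrite mulr_gt0 ?exprn_gt0.
      nra.
    by move=> hh; apply: (le_trans hh); rewrite ler_peMr// (le_trans ler01 hh).
  apply: (@le_trans _ _ (eps ^+ 2 * (N%:R * t + q / p * M%:R * t + 1))).
    by rewrite !mulrDr mulr1 lerD2l.
  rewrite ler_wpM2l ?(ltW e2)// MM.
  have -> : q / p = 1 - 2 * a by rewrite aE; field; rewrite gt_eqF.
  by move: (ler_wpM2r (ltW t_gt0) h3) h4; clear; lra.
Qed.

End fixed_noise.

Lemma block_positions (d s m : nat) : (s * m <= d)%N ->
  exists pos : 'I_s -> 'I_m -> 'I_d,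
    forall b i b' i', pos b i = pos b' i' -> b = b' /\ i = i'.
Proof.
move=> smd.
have lt (b : 'I_s) (i : 'I_m) : (b * m + i < d)%N.
  apply: leq_trans smd; apply: (@leq_trans (b.+1 * m)).
    by rewrite mulSn addnC ltn_add2r.
  by rewrite leq_mul2r ltn_ord orbT.
exists (fun b i => Ordinal (lt b i)) => b i b' i' /(congr1 val) /= E.
have m0 : (0 < m)%N by exact: leq_ltn_trans (ltn_ord i).
split; apply: val_inj => /=.
  by move: (congr1 (divn^~ m) E); rewrite !divnMDl// !divn_small// !addn0.
by move: (congr1 (modn^~ m) E); rewrite !modnMDl !modn_small.
Qed.

(** The gap 1 - q supplies all the constants: p = (1 + q)/2 leaves
room for the flat signal, b for the relative errors of the divergence and of
ln (del * m) against ln (d/s), and del, the ratio of the likelihood threshold to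
the block size, for the term C / m of the Fano-type bound; rho = del remains. *)
Lemma minimax_risk_lower_bound (R : realType) (sigma q : R) :
  0 < sigma -> 0 < q -> q < 1 ->
  exists X0 L0 gamma rho : R, [/\ 0 < gamma, 0 < rho &
  forall (eps r : R) (disp : measure_display) (T : measurableType disp)
    (P : probability T R) (d s : nat) (xi : 'I_d * int -> {RV P >-> R})
    (v : int -> R),
  0 < eps -> iid_std_normal P xi -> (1 <= s <= d)%N ->
  X0 <= ln eps^-1 -> L0 <= ln (d%:R / s%:R) ->
  ln (d%:R / s%:R) <= gamma * ln eps^-1 ->
  Theta sigma r v ->
  (\esum_(l in [set: int]) (v l ^+ 4)%:E <=
    (4 * eps ^+ 4 * q * ln (d%:R / s%:R))%:E)%E ->
  (rho%:E <= minimax_risk P sigma eps r d s xi)%E].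
Proof.
move=> s0 q0 q1.
have [p pE] : exists p : R, p = (1 + q) / 2 by eexists.
have [b bE] : exists b : R, b = (1 - p) / 6 by eexists.
have [del delE] : exists del : R, del = (1 - p) / 4 by eexists.
have p1 : p < 1 by lra.
have qp : q < p by lra.
have p0 : 0 < p by lra.
have b0 : 0 < b by lra.
have b1 : b <= 1 by lra.
have del0 : 0 < del by lra.
have pb : p * (1 + b) ^+ 2 <= (1 + p) / 2 by rewrite bE; nra.
have b10 : 0 <= 1 + b by lra.
have bt0 : 0 < b / 200 by lra.
have bt1 : b / 200 <= 1 by lra.
have [X0 [gamma [gamma0 sig]]] := flat_signal_exists s0 q0 qp (ltW p1) bt0 bt1.
(* c0 gathers the additive losses in ln (del * m) - 1 >= ln (d / s) - c0. *)
have [c0 c0E] : exists c0 : R, c0 = 1 + ln (2 / del) by eexists.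
have c00 : 0 < c0.
  rewrite c0E ltr_pwDl// ln_ge0// ler_pdivlMr//; lra.
exists X0, (2 + c0 * (1 + b) / b), gamma, del; split => //.
move=> eps r disp T P d s xi v eps0 iid /andP[s1 sd] xX LL Lx Tv S4.
set L := ln (d%:R / s%:R) in LL Lx S4.
have sR0 : (0 : R) < s%:R by rewrite ltr0n.
have dR0 : (0 : R) < d%:R by rewrite ltr0n (leq_trans s1).
have cb : c0 * (1 + b) / b = c0 / b + c0 by field; rewrite gt_eqF.
have cb0 : 0 < c0 / b by rewrite divr_gt0.
have L2 : 2 <= L by lra.
have Lc : 0 < L - c0 by lra.
have LcL : L <= (1 + b) * (L - c0).
  have : c0 * (1 + b) <= L * b by rewrite -ler_pdivrMr//; lra.
  lra.
have L1 : 1 <= L by move: L2; clear; lra.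
have [M [t [t_gt0 tb Kt ell rad]]] := sig eps r L v eps0 xX L1 Lx Tv S4.
pose m := (d %/ s)%N.
have dsE : expR L = d%:R / s%:R by rewrite lnK// posrE divr_gt0.
have ds3 : 3 <= d%:R / s%:R :> R.
  by rewrite -dsE; move: (expR_ge1Dx L) L2; clear; lra.
have mds : d%:R / s%:R <= 2 * m%:R :> R.
  have h : d%:R / s%:R <= m%:R + 1 :> R.
    rewrite ler_pdivrMr// natr1 -natrM ler_nat ltnW//.
    by rewrite /m mulnC; rewrite mulnC ltn_ceil.
  by move: h ds3; clear; lra.
have mR0 : 0 < m%:R :> R by move: ds3 mds; clear; lra.
have m0 : (0 < m)%N by rewrite -(ltr0n R).
have smd : (s * m <= d)%N by rewrite mulnC leq_divM.
have [pos pos_inj] := block_positions smd.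
have Mt0 : 0 < del * m%:R by rewrite mulr_gt0.
have lnM : L - c0 <= ln (del * m%:R) - 1.
  suff : L - ln (2 / del) <= ln (del * m%:R) by rewrite c0E; clear; lra.
  rewrite -ln_div ?posrE ?divr_gt0// ler_ln ?posrE ?divr_gt0//.
  rewrite ler_pdivrMr ?divr_gt0// (_ : del * m%:R * (2 / del) = 2 * m%:R)//.
  by field; rewrite gt_eqF.
have lnM0 : 0 < ln (del * m%:R) - 1 by exact: lt_le_trans lnM.
have lnM1 : 1 < ln (del * m%:R) by rewrite -subr_gt0.
pose tau := Num.sqrt t.
have tau2 : tau ^+ 2 = t by rewrite sqr_sqrtr// ltW.
have flat (g : 'I_M * bool -> bool) : Theta sigma r
    (fun l => \sum_k (l == freq k)%:R * ((-1) ^+ g k * (eps * tau))).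
  by apply: flat_signal_Theta => //; rewrite exprMn tau2.
apply: le_trans (minimax_risk_ge_fano eps0 iid pos_inj (@freq_inj M) m0 s1 Mt0 lnM1 flat).
rewrite lee_fin mulfK ?gt_eqF// tau2 card_prod card_ord card_bool muln2.
have kl : M.*2%:R * kl_rate t <= p * L * (1 + b).
  apply: (@le_trans _ _ (M.*2%:R * (t ^+ 2 / 4 * (1 + b)))).
    by rewrite ler_wpM2l// kl_rate_small// ltW.
  have -> : M.*2%:R * (t ^+ 2 / 4 * (1 + b)) = M.*2%:R * t ^+ 2 / 4 * (1 + b) by field.
  by rewrite Kt le_eqVlt; apply/orP; left; apply/eqP; field.
have : M.*2%:R * kl_rate t / (ln (del * m%:R) - 1) <= p * (1 + b) ^+ 2.
  rewrite ler_pdivrMr//; apply: le_trans kl _.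
  have -> : p * L * (1 + b) = p * (1 + b) * L by ring.
  have -> : p * (1 + b) ^+ 2 * (ln (del * m%:R) - 1) =
     p * (1 + b) * ((1 + b) * (ln (del * m%:R) - 1)) by ring.
  apply: ler_wpM2l; first exact: mulr_ge0 (ltW p0) b10.
  by apply: le_trans LcL _; exact: ler_wpM2l.
by move=> /le_trans/(_ pb); move: delE; clear; lra.
Qed.

(** * Passage to the limit *)

Lemma limf_esup_lt1 (R : realType) (f : R -> \bar R) (F : set (set R)) :
  (limf_esup f F < 1)%E -> exists c : R, [/\ 0 < c, c < 1 &
    exists2 V : set R, F V & forall x, V x -> (f x <= c%:E)%E].
Proof.
move=> /ereal_inf_lt [_ [V FV <-]].
have le x : V x -> (f x <= ereal_sup (f @` V))%E.
  by move=> Vx; apply: ereal_sup_ubound; exists x.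
move: (ereal_sup _) le => [a| |] le //.
- rewrite lte_fin => a1.
  exists (Num.max a (1 / 2)); split.
  + by rewrite lt_max; apply/orP; right; lra.
  + by rewrite gt_max a1/=; lra.
  + exists V => // x /le h; apply: (le_trans h).
    by rewrite lee_fin le_max lexx.
- move=> _; exists (1 / 2); split; [lra|lra|].
  by exists V => // x /le h; apply: (le_trans h); rewrite leNye.
Qed.

Lemma limf_einf_ge (R : realType) (f : R -> \bar R) (F : set (set R)) (rho : \bar R) :
  F [set x | (rho <= f x)%E] -> (rho <= limf_einf f F)%E.
Proof.
move=> FV; rewrite limf_einfE.
apply: le_ereal_sup_tmp; eexists; first by eexists; first exact: FV.
by apply/ereal_infP => _ [x /= h <-].
Qed.

(** The infimum defining [u_fun] need not be attained, whence the slack between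
c^2 and q.  An empty class has infimum +oo, which the hypothesis excludes. *)
Lemma u_fun_witness (R : realType) (sigma eps r c q L : R) :
  0 < eps -> 0 < c -> c ^+ 2 < q -> 0 < L ->
  (u_fun sigma eps r / (Num.sqrt (2 * L))%:E <= c%:E)%E ->
  exists2 v, Theta sigma r v &
    (\esum_(l in [set: int]) (v l ^+ 4)%:E <= (4 * eps ^+ 4 * q * L)%:E)%E.
Proof.
move=> eps0 c0 cq L0; have sq0 : 0 < Num.sqrt (2 * L) by rewrite sqrtr_gt0 mulr_gt0.
rewrite inver (gt_eqF sq0) lee_pdivrMr// /u_fun.
set I := ereal_inf _.
have e4 : 0 < 2 * eps ^+ 4 by rewrite mulr_gt0 ?exprn_gt0.
have -> : (c%:E * (Num.sqrt (2 * L))%:E = sqrte (c ^+ 2 * (2 * L))%:E)%E.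
  rewrite -EFinM /sqrte [in RHS]sqrtrM ?sqr_ge0// sqrtr_sqr ger0_norm// ltW//.
rewrite lee_sqrt; last by rewrite lee_fin mulr_ge0 ?sqr_ge0// mulr_ge0// ltW.
move=> h.
have : (I < (4 * eps ^+ 4 * q * L)%:E)%E.
  apply: (@le_lt_trans _ _ ((2 * eps ^+ 4)%:E * (c ^+ 2 * (2 * L))%:E)%E).
    by rewrite -lee_pdivrMl// ; exact: h.
  rewrite -EFinM lte_fin.
  have -> : 2 * eps ^+ 4 * (c ^+ 2 * (2 * L)) = (4 * eps ^+ 4 * L) * c ^+ 2 by ring.
  have -> : 4 * eps ^+ 4 * q * L = (4 * eps ^+ 4 * L) * q by ring.
  by rewrite ltr_pM2l// !mulr_gt0 ?exprn_gt0.
by move=> /ereal_inf_lt [_ [v Tv <-]] /ltW; exists v.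
Qed.

Theorem theorem6 (R : realType) (sigma : R) (d s : R -> nat) (r : R -> R)
    (disp : R -> measure_display)
    (Omega : forall eps : R, measurableType (disp eps))
    (P : forall eps : R, probability (Omega eps) R)
    (xi : forall eps : R, 'I_(d eps) * int -> {RV (P eps) >-> R}) :
  0 < sigma ->
  (forall eps : R, 0 < eps -> iid_std_normal (P eps) (xi eps)) ->
  d eps @[eps --> 0^'+] --> \oo ->
  (fun eps : R => ln (d eps)%:R) =o_ (0^'+) (fun eps : R => ln eps^-1) ->
  (forall eps : R, 0 < eps -> (1 <= s eps <= d eps)%N) ->
  (fun eps : R => (s eps)%:R : R) =o_ (0^'+) (fun eps : R => (d eps)%:R : R) ->
  (forall eps : R, 0 < eps -> 0 < r eps) ->
  (limf_esup (fun eps : R => u_fun sigma eps (r eps) /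
      (Num.sqrt (2 * ln ((d eps)%:R / (s eps)%:R)))%:E) 0^'+ < 1)%E ->
  (0 < limf_einf (fun eps : R =>
      minimax_risk (P eps) sigma eps (r eps) (d eps) (s eps) (xi eps)) 0^'+)%E.
Proof.
move=> sigma0 iid _ lndo sd so _ /limf_esup_lt1 [c [c0 c1 [V FV Vc]]].
pose q := (c ^+ 2 + 1) / 2.
have cc1 : c ^+ 2 < 1 by rewrite expr_lt1// ltW.
have c20 : 0 < c ^+ 2 by rewrite exprn_gt0.
have q0 : 0 < q by rewrite /q; lra.
have q1 : q < 1 by rewrite /q; lra.
have cq : c ^+ 2 < q by rewrite /q; lra.
have [X0 [L0 [gamma [rho [gamma0 rho0 reg]]]]] := minimax_risk_lower_bound sigma0 q0 q1.
apply: (@lt_le_trans _ _ rho%:E); first by rewrite lte_fin.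
apply: limf_einf_ge.
have k0 : 0 < expR (- (Num.max L0 1)) by exact: expR_gt0.
move/eqoP : lndo => /(_ gamma gamma0) lnd.
move/eqoP : so => /(_ _ k0) sde.
near=> eps.
have eps0 : 0 < eps by near: eps; exact: nbhs_right_gt.
have xX : X0 <= ln eps^-1.
  have : eps < expR (- X0) by near: eps; apply: nbhs_right_lt; exact: expR_gt0.
  move=> h; rewrite -[X0]expRK ler_ln ?posrE ?expR_gt0 ?invr_gt0//.
  by rewrite -[expR X0]invrK lef_pV2 ?posrE ?invr_gt0 ?expR_gt0// -expRN ltW.
have x0 : 0 <= ln eps^-1.
  have : eps < 1 by near: eps; exact: nbhs_right_lt.
  by move=> h; rewrite ln_ge0// invf_ge1// ltW.
have Veps : V eps by near: eps.
have := sd _ eps0 => /andP[s1 sd1].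
have sR0 : (0 : R) < (s eps)%:R by rewrite ltr0n.
have dR0 : (0 : R) < (d eps)%:R by rewrite ltr0n (leq_trans s1).
have LL0 : Num.max L0 1 <= ln ((d eps)%:R / (s eps)%:R).
  have : `|(s eps)%:R : R| <= expR (- (Num.max L0 1)) * `|(d eps)%:R : R|.
    by near: eps; exact: sde.
  rewrite !ger0_norm// expRN mulrC ler_pdivlMr ?expR_gt0// mulrC => h.
  by rewrite -[leLHS]expRK ler_ln ?posrE ?divr_gt0 ?expR_gt0// ler_pdivlMr.
have Lx : ln ((d eps)%:R / (s eps)%:R) <= gamma * ln eps^-1.
  have : `|ln (d eps)%:R : R| <= gamma * `|ln eps^-1|.
    by near: eps; exact: lnd.
  rewrite (ger0_norm x0) => h; apply: le_trans h.
  apply: le_trans (ler_norm _); rewrite ler_ln ?posrE ?divr_gt0//.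
  by rewrite ler_pdivrMr// ler_peMr// ler1n.
move: LL0; rewrite ge_max => /andP[LL0 L1].
have [v Tv S4] := u_fun_witness eps0 c0 cq (lt_le_trans ltr01 L1) (Vc _ Veps).
apply: (reg eps (r eps) _ _ (P eps) (d eps) (s eps) (xi eps) v) => //.
- exact: iid.
- exact: sd.
Unshelve. all: by end_near.
Qed.
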